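(* Let $p$ be a prime, and suppose that MC$\mathbf{1}$ holds, i.e. for every finite group $H$ with Sylow $p$-subgroup $Q$, $(\mathbb{C}[H], \mathbb{C}[N_H(Q)])$ is an M-pair. Then for all finite groups $G$ and all normalized multiplicative $3$-cocycles $\omega\in Z^3(G,\mathbb{C}^* )$, the pair of twisted quantum doubles $(D^{\omega}(G), D^{\omega}(N))$ is an M-pair, where $N = N_G(P)$ is the normalizer in $G$ of a Sylow $p$-subgroup $P$ of $G$.
   Context: All algebras and modules are finite-dimensional over $\mathbb{C}$. The prime $p$ is fixed. For an algebra $A$, $\mu(A)$ denotes the number of inequivalent simple $A$-modules of dimension coprime to $p$. A pair of algebras $(A,B)$ is an M-pair if $\mu(A)=\mu(B)$. For a finite group $G$ and a normalized $3$-cocycle $\omega\in Z^3(G,\mathbb{C}^* )$ (trivial $G$-action on $\mathbb{C}^*$), define for $x,g,h\in G$ $$\alpha_x(g,h) = \frac{\omega(x,g,h)\,\omega(g,h,(gh)^{-1}x(gh))}{\omega(g,g^{-1}xg,h)}.$$ As an algebra, the twisted quantum double $D^{\omega}(G)$ has underlying space $\mathbb{C}[G]^*\otimes_{\mathbb{C}}\mathbb{C}[G]$, where $\mathbb{C}[G]^*$ is the space of complex functions on $G$ with basis the delta functions $e(x)$, $x\in G$, and associative product $$(e(x)\otimes g)(e(y)\otimes h) = \alpha_x(g,h)\,\delta_{x,\,gyg^{-1}}\, e(x)\otimes gh.$$ $D^{\omega}(N)$ is the same construction for the group $N$ and the restriction of $\omega$ to $N$. (Only the algebra structure is relevant here.)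 *)

(* Defs.v *)
From HB Require Import structures.
From mathcomp Require Import all_boot all_order all_algebra all_fingroup.
From mathcomp Require Import all_solvable all_field.
From mathcomp Require Import finmap boolp classical_sets cardinality reals.
From mathcomp Require Import complex ring.

Set Implicit Arguments.
Unset Strict Implicit.
Unset Printing Implicit Defensive.

Import GRing.Theory.

Local Open Scope ring_scope.

Section Modules.
Variables (F : fieldType) (A : falgType F).

(* A finite-dimensional left A-module, on a space of column vectors. *)
Record lmodule := LModule {
  mod_dim : nat;
  mod_act :> {lrmorphism A -> 'M[F]_mod_dim}
}.

Definition simple_module (M : lmodule) : Prop :=
  (0 < mod_dim M)%N /\
  forall U : {vspace 'cV[F]_(mod_dim M)},
    (forall (a : A) (v : 'cV[F]_(mod_dim M)), v \in U -> M a *m v \in U) ->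
    U = 0%VS \/ U = fullv.

Definition module_equiv (M N : lmodule) : Prop :=
  exists (f : 'M[F]_(mod_dim N, mod_dim M)) (g : 'M[F]_(mod_dim M, mod_dim N)),
    [/\ f *m g = 1%:M, g *m f = 1%:M & forall a : A, f *m M a = N a *m f].

Local Open Scope classical_set_scope.

Definition p'_simple_classes (p : nat) : set (set lmodule) :=
  [set module_equiv M | M in
     [set M | simple_module M /\ coprime (mod_dim M) p]].

(* A finite-dimensional algebra has finitely many classes of simple modules,
   so the default value of fset_set on infinite sets plays no role. *)
Definition mu (p : nat) : nat := #|` fset_set (p'_simple_classes p)|%fset.

End Modules.

Definition M_pair (F : fieldType) (p : nat) (A B : falgType F) : Prop :=
  mu A p = mu B p.

Section BilinearExtension.
Variables (F : fieldType) (I : finType).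
Implicit Types f g h : {ffun I -> F^o}.

Definition basis_elt (i : I) : {ffun I -> F^o} := [ffun j => (j == i)%:R].

Definition bilinear_ext (m : I -> I -> {ffun I -> F^o}) f g : {ffun I -> F^o} :=
  \sum_i \sum_j (f i * g j) *: m i j.

Variable m : I -> I -> {ffun I -> F^o}.
Local Notation mul := (bilinear_ext m).

Lemma basis_eltE f : f = \sum_i f i *: basis_elt i.
Proof.
apply/ffunP => k; rewrite sum_ffunE (bigD1 k) //= big1 => [|i ik].
  by rewrite addr0 !ffunE eqxx; exact/esym/mulr1.
by rewrite !ffunE eq_sym (negbTE ik); exact: mulr0.
Qed.

Lemma bilinear_extDl : left_distributive mul +%R.
Proof.
move=> f g h; rewrite -big_split /=; apply: eq_bigr => i _.
rewrite -big_split /=; apply: eq_bigr => j _.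
by rewrite ffunE mulrDl scalerDl.
Qed.

Lemma bilinear_extDr : right_distributive mul +%R.
Proof.
move=> f g h; rewrite -big_split /=; apply: eq_bigr => i _.
rewrite -big_split /=; apply: eq_bigr => j _.
by rewrite ffunE mulrDr scalerDl.
Qed.

Lemma bilinear_extZl (a : F) f g : a *: mul f g = mul (a *: f) g.
Proof.
rewrite scaler_sumr; apply: eq_bigr => i _.
rewrite scaler_sumr; apply: eq_bigr => j _.
by rewrite ffunE scalerA mulrA.
Qed.

Lemma bilinear_extZr (a : F) f g : a *: mul f g = mul f (a *: g).
Proof.
rewrite scaler_sumr; apply: eq_bigr => i _.
rewrite scaler_sumr; apply: eq_bigr => j _.
rewrite ffunE scalerA; congr (_ *: _); rewrite [RHS]mulrCA; reflexivity.
Qed.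

Lemma bilinear_ext0l f : mul 0 f = 0.
Proof. by have := bilinear_extZl 0 0 f; rewrite !scale0r => <-. Qed.

Lemma bilinear_ext0r f : mul f 0 = 0.
Proof. by have := bilinear_extZr 0 f 0; rewrite !scale0r => <-. Qed.

Lemma bilinear_ext_suml (J : finType) (P : pred J) (f : J -> {ffun I -> F^o}) g :
  mul (\sum_(j | P j) f j) g = \sum_(j | P j) mul (f j) g.
Proof.
apply: (big_morph (mul^~ g)) => [f1 f2|]; first exact: bilinear_extDl.
exact: bilinear_ext0l.
Qed.

Lemma bilinear_ext_sumr (J : finType) (P : pred J) (f : J -> {ffun I -> F^o}) g :
  mul g (\sum_(j | P j) f j) = \sum_(j | P j) mul g (f j).
Proof.
apply: (big_morph (mul g)) => [f1 f2|]; first exact: bilinear_extDr.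
exact: bilinear_ext0r.
Qed.

Lemma bilinear_ext_basis i j : mul (basis_elt i) (basis_elt j) = m i j.
Proof.
rewrite /bilinear_ext (bigD1 i) //= [X in _ + X]big1 => [|k ki]; last first.
  by rewrite big1 // => l _; rewrite !ffunE (negbTE ki) mul0r scale0r.
rewrite addr0 (bigD1 j) //= big1 => [|k ki]; last first.
  by rewrite !ffunE (negbTE ki) mulr0 scale0r.
by rewrite !ffunE !eqxx addr0 mulr1 scale1r.
Qed.

Lemma bilinear_ext_expandl f g :
  mul f g = \sum_i f i *: mul (basis_elt i) g.
Proof.
rewrite [in LHS](basis_eltE f) bilinear_ext_suml.
by apply: eq_bigr => i _; rewrite -bilinear_extZl.
Qed.

Lemma bilinear_ext_expandr f g :
  mul f g = \sum_i g i *: mul f (basis_elt i).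
Proof.
rewrite [in LHS](basis_eltE g) bilinear_ext_sumr.
by apply: eq_bigr => i _; rewrite -bilinear_extZr.
Qed.

Lemma bilinear_extA :
  (forall i j k, mul (basis_elt i) (m j k) = mul (m i j) (basis_elt k)) ->
  associative mul.
Proof.
move=> mA.
have mA3 i j h : mul (basis_elt i) (mul (basis_elt j) h) =
                 mul (mul (basis_elt i) (basis_elt j)) h.
  rewrite (bilinear_ext_expandr _ h) bilinear_ext_sumr.
  rewrite (bilinear_ext_expandr _ h); apply: eq_bigr => k _.
  by rewrite -bilinear_extZr !bilinear_ext_basis mA.
have mA2 i g h : mul (basis_elt i) (mul g h) = mul (mul (basis_elt i) g) h.
  rewrite (bilinear_ext_expandl g) bilinear_ext_sumr.
  rewrite (bilinear_ext_expandr _ g) bilinear_ext_suml.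
  by apply: eq_bigr => j _; rewrite -bilinear_extZr -bilinear_extZl mA3.
move=> f g h; rewrite (bilinear_ext_expandl f) (bilinear_ext_expandl f g).
by rewrite bilinear_ext_suml; apply: eq_bigr => i _; rewrite -bilinear_extZl mA2.
Qed.

Lemma bilinear_ext1 (e : {ffun I -> F^o}) :
  (forall i, mul e (basis_elt i) = basis_elt i) -> left_id e mul.
Proof.
move=> e1 f; rewrite bilinear_ext_expandr [RHS]basis_eltE.
by apply: eq_bigr => i _; rewrite e1.
Qed.

Lemma bilinear_ext1r (e : {ffun I -> F^o}) :
  (forall i, mul (basis_elt i) e = basis_elt i) -> right_id e mul.
Proof.
move=> e1 f; rewrite bilinear_ext_expandl [RHS]basis_eltE.
by apply: eq_bigr => i _; rewrite e1.
Qed.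

End BilinearExtension.

Definition group_alg (F : fieldType) (gT : finGroupType) := {ffun gT -> F^o}.

Section GroupAlgebra.
Variables (F : fieldType) (gT : finGroupType).

HB.instance Definition _ := Vector.on (group_alg F gT).

Definition group_alg_mul : group_alg F gT -> group_alg F gT -> group_alg F gT :=
  bilinear_ext (fun g h : gT => basis_elt F (g * h)%g).

Definition group_alg_one : group_alg F gT := basis_elt F 1%g.

Lemma group_alg_mulA : associative group_alg_mul.
Proof.
by apply: bilinear_extA => i j k; rewrite !bilinear_ext_basis mulgA.
Qed.

Lemma group_alg_mul1 : left_id group_alg_one group_alg_mul.
Proof. by apply: bilinear_ext1 => i; rewrite bilinear_ext_basis mul1g. Qed.

Lemma group_alg_mul1r : right_id group_alg_one group_alg_mul.
Proof. by apply: bilinear_ext1r => i; rewrite bilinear_ext_basis mulg1. Qed.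

Lemma group_alg_oner_neq0 : group_alg_one != 0.
Proof.
apply/eqP => /ffunP/(_ 1%g); rewrite !ffunE eqxx => /eqP.
by rewrite oner_eq0.
Qed.

HB.instance Definition _ := GRing.Zmodule_isNzRing.Build (group_alg F gT)
  group_alg_mulA group_alg_mul1 group_alg_mul1r
  (bilinear_extDl _) (bilinear_extDr _) group_alg_oner_neq0.

HB.instance Definition _ := GRing.Lmodule_isLalgebra.Build F (group_alg F gT)
  (bilinear_extZl _).

HB.instance Definition _ := GRing.Lalgebra_isAlgebra.Build F (group_alg F gT)
  (bilinear_extZr _).

HB.instance Definition _ := Algebra_isFalgebra.Build F (group_alg F gT).

End GroupAlgebra.

(* Normalized multiplicative 3-cocycles, for the trivial action on F^*. *)
Record cocycle3 (F : fieldType) (gT : finGroupType) := Cocycle3 {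
  cocycle_fun :> gT -> gT -> gT -> F;
  cocycle_neq0 : forall a b c, cocycle_fun a b c != 0;
  cocycleP : forall a b c d,
    cocycle_fun b c d * cocycle_fun a (b * c)%g d * cocycle_fun a b c =
    cocycle_fun (a * b)%g c d * cocycle_fun a b (c * d)%g;
  cocycle1l : forall b c, cocycle_fun 1%g b c = 1;
  cocycle1m : forall a c, cocycle_fun a 1%g c = 1;
  cocycle1r : forall a b, cocycle_fun a b 1%g = 1
}.

Section Restriction.
Variables (F : fieldType) (gT : finGroupType) (w : cocycle3 F gT).
Variable H : {group gT}.

Let r (a b c : subg_of H) : F := w (sgval a) (sgval b) (sgval c).

Let r_neq0 a b c : r a b c != 0. Proof. exact: cocycle_neq0. Qed.

Let rP a b c d : r b c d * r a (b * c)%g d * r a b c =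
  r (a * b)%g c d * r a b (c * d)%g.
Proof. exact: cocycleP. Qed.

Let r1l b c : r 1%g b c = 1. Proof. exact: cocycle1l. Qed.
Let r1m a c : r a 1%g c = 1. Proof. exact: cocycle1m. Qed.
Let r1r a b : r a b 1%g = 1. Proof. exact: cocycle1r. Qed.

Definition restr_cocycle : cocycle3 F (subg_of H) :=
  Cocycle3 r_neq0 rP r1l r1m r1r.

End Restriction.

(* The basis vector of index (x, g) is e(x) (x) g. *)
Definition twisted_double (F : fieldType) (gT : finGroupType)
  (w : cocycle3 F gT) := {ffun gT * gT -> F^o}.

Section TwistedDouble.
Variables (F : fieldType) (gT : finGroupType) (w : cocycle3 F gT).

Definition alpha (x g h : gT) : F :=
  w x g h * w g h ((g * h)^-1 * x * (g * h))%g / w g (g^-1 * x * g)%g h.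

Lemma alpha_neq0 x g h : alpha x g h != 0.
Proof. by rewrite !mulf_neq0 ?invr_neq0 ?cocycle_neq0. Qed.

Lemma alpha1l x h : alpha x 1%g h = 1.
Proof.
rewrite /alpha cocycle1m cocycle1l invg1 !mul1g mulg1.
by rewrite [w 1%g _ _]cocycle1l invr1 !mulr1.
Qed.

Lemma alpha1r x g : alpha x g 1%g = 1.
Proof. by rewrite /alpha cocycle1r cocycle1m cocycle1r invr1 !mulr1. Qed.

Lemma alphaM x g h k :
  alpha x g h * alpha x (g * h)%g k =
  alpha x g (h * k)%g * alpha (g^-1 * x * g)%g h k.
Proof.
set y := (g^-1 * x * g)%g; set z := (h^-1 * y * h)%g.
pose t := (k^-1 * z * k)%g.
have zE : ((g * h)^-1 * x * (g * h))%g = z by rewrite /z /y invMg !mulgA.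
have tE : ((g * h * k)^-1 * x * (g * h * k))%g = t.
  by rewrite /t /z /y !invMg !mulgA.
have tE' : ((g * (h * k))^-1 * x * (g * (h * k)))%g = t by rewrite -tE !mulgA.
have tE'' : ((h * k)^-1 * y * (h * k))%g = t.
  by rewrite /t /z invMg !mulgA.
rewrite /alpha -/y zE tE tE' tE'' -/z.
have yE : (g * y = x * g)%g by rewrite /y !mulgA mulgV mul1g.
have hzE : (h * z = y * h)%g by rewrite /z !mulgA mulgV mul1g.
have ktE : (k * t = z * k)%g by rewrite /t -!mulgA mulKVg.
have := cocycleP w x g h k; have := cocycleP w g y h k.
have := cocycleP w g h z k; have := cocycleP w g h k t.
rewrite yE hzE ktE => E4 E3 E2 E1.
have nz := cocycle_neq0 w.
have E : (w x g h * w g h z) * (w x (g * h)%g k * w (g * h)%g k t) *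
         (w g y (h * k)%g * w h z k) =
         (w x g (h * k)%g * w g (h * k)%g t) * (w y h k * w h k t) *
         (w g y h * w (g * h)%g z k).
  apply: (mulfI (mulf_neq0 (mulf_neq0 (nz g h k) (nz g (y * h)%g k))
    (mulf_neq0 (nz (x * g)%g h k) (nz g h (z * k)%g)))).
  transitivity ((w g h k * w x (g * h)%g k * w x g h) *
    (w h z k * w g (y * h)%g k * w g h z) *
    (w (x * g)%g h k * w g y (h * k)%g) *
    (w (g * h)%g k t * w g h (z * k)%g)); first by ring.
  by rewrite E1 E3 -E2 -E4; ring.
by rewrite !mulf_div; apply/eqP; rewrite eqr_div ?mulf_neq0 ?E.
Qed.

HB.instance Definition _ := Vector.on (twisted_double w).

Definition twisted_double_mul :
    twisted_double w -> twisted_double w -> twisted_double w :=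
  bilinear_ext (fun u v : gT * gT => let: (x, g) := u in let: (y, h) := v in
    if x == (g * y * g^-1)%g then alpha x g h *: basis_elt F (x, (g * h)%g)
    else 0).

Definition twisted_double_one : twisted_double w :=
  \sum_(x : gT) basis_elt F (x, 1%g).

Lemma twisted_double_mul_basis x g y h :
  twisted_double_mul (basis_elt F (x, g)) (basis_elt F (y, h)) =
  if x == (g * y * g^-1)%g then alpha x g h *: basis_elt F (x, (g * h)%g) else 0.
Proof. exact: bilinear_ext_basis. Qed.

Lemma twisted_double_mulA : associative twisted_double_mul.
Proof.
apply: bilinear_extA => -[x g] [y h] [z k].
have [->|yz] := eqVneq y (h * z * h^-1)%g; last first.
  have [xy|_] := eqVneq x (g * y * g^-1)%g; last first.
    by rewrite bilinear_ext0r bilinear_ext0l.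
  rewrite bilinear_ext0r -bilinear_extZl bilinear_ext_basis.
  case: eqP => [xz|]; last by rewrite scaler0.
  case/eqP: yz; apply: (mulgI g); apply: (mulIg g^-1%g).
  by rewrite -xy xz invMg !mulgA.
rewrite -bilinear_extZr bilinear_ext_basis.
have [xE|_] := eqVneq x _; last by rewrite bilinear_ext0l scaler0.
rewrite -bilinear_extZl bilinear_ext_basis.
have -> : (g * h * z * (g * h)^-1 = x)%g by rewrite xE invMg !mulgA.
rewrite eqxx !scalerA mulgA alphaM mulrC; congr (_ * alpha _ _ _ *: _).
by rewrite xE !mulgA mulVg mul1g mulgKV.
Qed.

Lemma twisted_double_mul1 : left_id twisted_double_one twisted_double_mul.
Proof.
apply: bilinear_ext1 => -[y h].
rewrite bilinear_ext_suml (bigD1 y) //= big1 => [|x xy].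
  by rewrite bilinear_ext_basis invg1 mulg1 mul1g eqxx alpha1l scale1r mul1g addr0.
by rewrite bilinear_ext_basis invg1 mulg1 mul1g (negbTE xy).
Qed.

Lemma twisted_double_mul1r : right_id twisted_double_one twisted_double_mul.
Proof.
apply: bilinear_ext1r => -[x g].
rewrite bilinear_ext_sumr (bigD1 (x ^ g)%g) //= big1 => [|y xy].
  rewrite bilinear_ext_basis conjgE !mulgA mulgV mul1g mulgK eqxx.
  by rewrite alpha1r scale1r mulg1 addr0.
rewrite bilinear_ext_basis; case: eqP => // xE.
by case/eqP: xy; rewrite xE conjgE !mulgA mulVg mul1g mulgKV.
Qed.

Lemma twisted_double_oner_neq0 : twisted_double_one != 0.
Proof.
apply/eqP => /ffunP/(_ (1, 1)%g); rewrite sum_ffunE (bigD1 1%g) //= big1 => [|x x1].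
  by rewrite !ffunE eqxx addr0 => /eqP; rewrite oner_eq0.
by rewrite ffunE xpair_eqE eq_sym (negbTE x1).
Qed.

HB.instance Definition _ := GRing.Zmodule_isNzRing.Build (twisted_double w)
  twisted_double_mulA twisted_double_mul1 twisted_double_mul1r
  (bilinear_extDl _) (bilinear_extDr _) twisted_double_oner_neq0.

HB.instance Definition _ := GRing.Lmodule_isLalgebra.Build F (twisted_double w)
  (bilinear_extZl _).

HB.instance Definition _ := GRing.Lalgebra_isAlgebra.Build F (twisted_double w)
  (bilinear_extZr _).

HB.instance Definition _ := Algebra_isFalgebra.Build F (twisted_double w).

End TwistedDouble.

Definition MC1 (F : fieldType) (p : nat) : Prop :=
  forall (hT : finGroupType) (Q : {group hT}), (p.-Sylow([set: hT]) Q)%g ->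
    M_pair p (group_alg F hT) (group_alg F (subg_of 'N(Q))).

(* Main.v *)
Require Import Defs.
From HB Require Import structures.
From mathcomp Require Import all_boot all_order all_algebra all_fingroup.
From mathcomp Require Import all_solvable all_field.
From mathcomp Require Import finmap boolp.
From mathcomp Require classical_sets cardinality.
From mathcomp Require Import reals complex ring.

Set Implicit Arguments.
Unset Strict Implicit.
Unset Printing Implicit Defensive.

Import GRing.Theory Num.Theory.
Local Open Scope ring_scope.

(** Write e(x) for the idempotent of D^w(G) attached to x in G.  The corner
    e(x) D e(x) is the group algebra of C_G(x) twisted by the 2-cocycle alpha_x,
    so that a simple D^w(G)-module lives on a single conjugacy class x^G and has
    dimension #|x^G| times the dimension of a simple module of that corner.
    The simple modules of dimension prime to p therefore live on the classes of
    size prime to p, that is, on those that meet C(P) for P a Sylow p-subgroup;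
    by Burnside's fusion argument these classes meet C(P) exactly in the classes
    of N(P).  For x in C(P), P is a Sylow p-subgroup of C_G(x) with normalizer
    C_N(x), so the theorem reduces to a McKay statement for projective
    representations of C_G(x).

    To get that statement, alpha_x is made to take values in the roots of unity
    (Schur); the twisted algebra then becomes the part of the group algebra of a
    central extension E of C_G(x) by a cyclic group <c> on which c acts by a fixed
    root of unity z.  The McKay hypothesis, applied to the quotients E / <c^d>,
    compares the sums of the counts over all z with z^d = 1.  The counts for the
    primitive d-th roots of unity agree with each other by Galois conjugacy, so
    induction on d separates the individual roots (projective_mckay).

    No module is ever transported from one algebra to another: everything is
    expressed by traces.  Each of the algebras carries the trace t of its regular
    representation, with dual bases (e_i), (e'_i).  The element
    casimir2 = sum_ij e_i e_j e'_i e'_j acts on a simple module of dimension d as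
    the scalar d^-2, whence, for every polynomial q,

      t (q(casimir2) y) = sum_V (dim V) q((dim V)^-2) tr_V(y)

    (trace_casimir_poly).  If q(d^-2) is d^-2 or 0 according as d is prime to p or
    not, the value at y = 1 is the number mu of the theorem (trace_sieve and
    p'_character1), and other central idempotents y count the simple modules on
    which y acts as 1.  For group algebras and for D^w(G), casimir2 is a multiple of a
    sum of commutators of basis elements, so that it is compatible with quotients of groups (inflation_trace) and with the
    corners of D^w(G) (corner_trace).  Rationality of the coefficients of
    casimir2 in a group algebra is also what makes the Galois argument possible
    inside an arbitrary algebraically closed field of characteristic 0: it only
    needs the irreducibility of the cyclotomic polynomials, and no automorphism of
    the field. *)

(** * Schur's lemma *)

Section Schur.
Variables (F : numClosedFieldType) (A : falgType F).
Implicit Types V W : lmodule A.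

Definition intertwines V W (X : 'M[F]_(mod_dim W, mod_dim V)) : Prop :=
  forall a : A, X *m V a = W a *m X.

Lemma simple_intertwiner_inj V W (X : 'M[F]_(mod_dim W, mod_dim V)) :
  simple_module V -> intertwines X -> X != 0 ->
  forall v : 'cV[F]_(mod_dim V), X *m v = 0 -> v = 0.
Proof.
case=> _ Vsimple iX X0 v Xv0.
pose f := linfun (mulmx X : 'cV[F]_(mod_dim V) -> 'cV[F]_(mod_dim W)).
have vf u : (u \in lker f) = (X *m u == 0) by rewrite memv_ker lfunE.
have [a u|kf0|kfT] := Vsimple (lker f).
- by rewrite !vf mulmxA iX -mulmxA => /eqP->; rewrite mulmx0.
- by apply/eqP; rewrite -memv0 -kf0 vf Xv0.
- case/eqP: X0; apply/trmx_inj/row_matrixP => i; rewrite trmx0 row0 -tr_col.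
  rewrite colE; have : delta_mx i 0 \in lker f by rewrite kfT memvf.
  by rewrite vf => /eqP ->; rewrite trmx0.
Qed.

Lemma simple_intertwiner_surj V W (X : 'M[F]_(mod_dim W, mod_dim V)) :
  simple_module W -> intertwines X -> X != 0 ->
  forall w : 'cV[F]_(mod_dim W), exists v, w = X *m v.
Proof.
case=> _ Wsimple iX X0 w.
pose f := linfun (mulmx X : 'cV[F]_(mod_dim V) -> 'cV[F]_(mod_dim W)).
have [a u|kf0|kfT] := Wsimple (limg f).
- case/memv_imgP=> v _ ->; rewrite lfunE /= mulmxA -iX -mulmxA.
  by apply/memv_imgP; exists (V a *m v); rewrite ?memvf ?lfunE.
- case/eqP: X0; apply/trmx_inj/row_matrixP => i; rewrite trmx0 row0 -tr_col.
  have : f (delta_mx i 0) \in limg f by rewrite memv_img ?memvf.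
  by rewrite kf0 memv0 lfunE /= -colE => /eqP ->; rewrite trmx0.
- have : w \in limg f by rewrite kfT memvf.
  by case/memv_imgP=> v _ ->; exists v; rewrite lfunE.
Qed.

Lemma schur_equiv V W (X : 'M[F]_(mod_dim W, mod_dim V)) :
  simple_module V -> simple_module W -> intertwines X -> X != 0 ->
  module_equiv V W.
Proof.
move=> Vs Ws iX X0; exists X, (pinvmx X^T)^T.
have Xfree : row_free X^T.
  rewrite -kermx_eq0; apply/eqP/row_matrixP => i; rewrite row0.
  apply: trmx_inj; rewrite trmx0; apply: (simple_intertwiner_inj Vs iX X0).
  apply: trmx_inj; rewrite trmx_mul !trmxK trmx0.
  by apply/sub_kermxP; rewrite row_sub.
have Xfull : row_full X^T.
  rewrite -sub1mx; apply/row_subP => i.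
  have [v Ev] := simple_intertwiner_surj Ws iX X0 (row i 1%:M)^T.
  by rewrite -[row i _]trmxK Ev trmx_mul submxMl.
split=> //; apply: trmx_inj; rewrite trmx_mul trmxK trmx1.
  exact: mulVpmx.
exact: mulmxVp.
Qed.

Lemma schur_scalar V (X : 'M[F]_(mod_dim V)) :
  simple_module V -> @intertwines V V X -> exists a, X = a%:M.
Proof.
move=> Vs iX; have [a] := eigenvalue_closed X^T Vs.1.
case/eigenvalueP=> u uX u0; exists a.
apply/eqP; rewrite -subr_eq0; apply/negPn/negP => Xa0.
have iXa : @intertwines V V (X - a%:M).
  by move=> b; rewrite mulmxBl mulmxBr iX scalar_mxC.
case/eqP: u0; apply: trmx_inj; rewrite trmx0.
apply: (simple_intertwiner_inj Vs iXa Xa0).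
apply: trmx_inj; rewrite trmx_mul trmxK linearB /= tr_scalar_mx mulmxBr uX.
by rewrite mul_mx_scalar subrr trmx0.
Qed.

Lemma module_equiv_refl V : module_equiv V V.
Proof. by exists 1%:M, 1%:M; split=> [||a]; rewrite ?mul1mx ?mulmx1. Qed.

Lemma module_equiv_sym V W : module_equiv V W -> module_equiv W V.
Proof.
case=> f [g [fg gf fV]]; exists g, f; split=> // a.
by rewrite -[g *m W a]mulmx1 -fg !mulmxA -(mulmxA g) -fV mulmxA gf mul1mx.
Qed.

Lemma module_equiv_trans V W U :
  module_equiv V W -> module_equiv W U -> module_equiv V U.
Proof.
case=> f [g [fg gf fV]] [f' [g' [fg' gf' fV']]].
exists (f' *m f), (g *m g'); split=> [||a].
- by rewrite mulmxA -(mulmxA f') fg mulmx1.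
- by rewrite mulmxA -(mulmxA g) gf' mulmx1.
- by rewrite -mulmxA fV !mulmxA fV'.
Qed.

Lemma module_equiv_dim V W : module_equiv V W -> mod_dim V = mod_dim W.
Proof.
case=> f [g [fg gf _]]; apply/eqP; rewrite eqn_leq.
have rk m n (B : 'M[F]_(m, n)) (C : 'M[F]_(n, m)) : C *m B = 1%:M -> (n <= m)%N.
  by move=> CB; rewrite -(mxrank1 F n) -CB (leq_trans (mxrankM_maxr _ _)) ?rank_leq_row.
by rewrite (rk _ _ _ _ fg) (rk _ _ _ _ gf).
Qed.

End Schur.

(** * Algebras with a regular trace form *)

(** A symmetric trace with dual bases, in the normalization that belongs to the
    regular representation.  The last field is what fixes the normalization: it
    says that the Casimir averaging of an operator preserves its trace. *)
Record trace_form (F : fieldType) (A : falgType F) := TraceForm {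
  tf_index : finType;
  tf_basis : tf_index -> A;
  tf_dual : tf_index -> A;
  tf_trace : {scalar A};
  tf_traceC : forall x y, tf_trace (x * y) = tf_trace (y * x);
  tf_expand : forall x, x = \sum_i tf_trace (x * tf_dual i) *: tf_basis i;
  tf_orth : forall i j, tf_trace (tf_basis i * tf_dual j) = (i == j)%:R;
  tf_sum1 : \sum_i tf_dual i * tf_basis i = 1
}.

Arguments tf_basis {F A} t.
Arguments tf_dual {F A} t.
Arguments tf_traceC {F A} t.
Arguments tf_expand {F A} t.
Arguments tf_orth {F A} t.
Arguments tf_sum1 {F A} t.

(** The averaging x |-> sum_i e_i x e'_i sends x to tr(x)/d on a simple module of
    dimension d.  Applied to x = e_j it gives tr(e_j)/d, and summing against e'_j
    divides by d once more: this double average is the scalar d^-2. *)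
Definition casimir2 (F : fieldType) (A : falgType F) (T : trace_form A) : A :=
  \sum_i \sum_j tf_basis T i * tf_basis T j * tf_dual T i * tf_dual T j.

Section TraceFormTheory.
Variables (F : fieldType) (A : falgType F) (T : trace_form A).
Local Notation t := (tf_trace T).
Local Notation e := (tf_basis T).
Local Notation e' := (tf_dual T).

Lemma tf_nondeg x : (forall y, t (y * x) = 0) -> x = 0.
Proof.
by move=> tx; rewrite (tf_expand T x) big1 // => i _; rewrite tf_traceC tx scale0r.
Qed.

(** The difference of the two sides is orthogonal to every basis element. *)
Lemma tf_expand_dual x : x = \sum_i t (x * e i) *: e' i.
Proof.
apply/eqP; rewrite -subr_eq0; apply/eqP/tf_nondeg => y.
rewrite (tf_expand T y) mulr_suml linear_sum big1 //= => j _.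
rewrite -scalerAl linearZ /= mulrBr linearB /= mulr_sumr linear_sum /=.
rewrite (bigD1 j) //= big1 => [|i ij]; rewrite -scalerAr linearZ /= tf_orth.
  by rewrite eqxx mulr1 (tf_traceC T (e j) x) addr0 subrr mulr0.
by rewrite eq_sym (negbTE ij) mulr0.
Qed.

End TraceFormTheory.

Section ModuleTrace.
Variables (F : fieldType) (A : falgType F) (V : lmodule A).

Lemma lmodM x y : V (x * y) = V x *m V y. Proof. exact: rmorphM. Qed.
Lemma lmod1 : V 1 = 1%:M. Proof. exact: rmorph1. Qed.

Definition character (x : A) : F := \tr (V x).

Lemma character_is_scalar : scalar character.
Proof. by move=> a x y; rewrite /character linearP /= linearP. Qed.
HB.instance Definition _ :=
  GRing.isSemilinear.Build F A F *%R character
    (GRing.semilinear_linear character_is_scalar).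

Lemma characterC x y : character (x * y) = character (y * x).
Proof. by rewrite /character !lmodM mxtrace_mulC. Qed.

Lemma character1 : character 1 = (mod_dim V)%:R.
Proof. by rewrite /character lmod1 mxtrace1. Qed.

End ModuleTrace.

Lemma mxtrace_delta (R : pzSemiRingType) n (i j : 'I_n) :
  \tr (delta_mx i j) = (i == j)%:R :> R.
Proof.
rewrite /mxtrace (bigD1 i) //= big1 => [|k ki]; rewrite mxE ?eqxx ?addr0 //.
by rewrite (negbTE ki).
Qed.

Section Casimir.
Variables (F : numClosedFieldType) (A : falgType F) (T : trace_form A).
Local Notation t := (tf_trace T).
Local Notation e := (tf_basis T).
Local Notation e' := (tf_dual T).
Implicit Types V W : lmodule A.

Definition casimir_mx V W (X : 'M[F]_(mod_dim W, mod_dim V)) :=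
  \sum_i W (e i) *m X *m V (e' i).

(** Moving a from left to right amounts to expanding a e_i on the basis and
    e'_j a on the dual basis: both have the same coefficients, by cyclicity of the
    trace. *)
Lemma casimir_intertwines V W (X : 'M[F]_(mod_dim W, mod_dim V)) :
  intertwines (casimir_mx X).
Proof.
move=> a; rewrite mulmx_suml mulmx_sumr.
transitivity (\sum_i \sum_j t (e' i * a * e j) *: (W (e i) *m X *m V (e' j))).
  apply: eq_bigr => i _; rewrite -(mulmxA _ (V (e' i))) -lmodM.
  rewrite [in LHS](tf_expand_dual T (e' i * a)) raddf_sum /= mulmx_sumr.
  by apply: eq_bigr => j _; rewrite linearZ /= -scalemxAr.
rewrite exchange_big; apply: eq_bigr => j _ /=.
rewrite !mulmxA -lmodM [in RHS](tf_expand T (a * e j)) raddf_sum /= !mulmx_suml.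
apply: eq_bigr => i _; rewrite linearZ /= -!scalemxAl -mulrA.
by rewrite tf_traceC.
Qed.

Lemma casimir_neq V W (X : 'M[F]_(mod_dim W, mod_dim V)) :
  simple_module V -> simple_module W -> ~ module_equiv V W -> casimir_mx X = 0.
Proof.
move=> Vs Ws VW; apply/eqP/negPn/negP => /(schur_equiv Vs Ws) eVW.
exact/VW/eVW/casimir_intertwines.
Qed.

Lemma simple_dim_neq0 V : simple_module V -> (mod_dim V)%:R != 0 :> F.
Proof. by case=> V0 _; rewrite pnatr_eq0 -lt0n. Qed.

(** By Schur's lemma the average is a scalar, and it has the trace of X. *)
Lemma casimir_eq V (X : 'M[F]_(mod_dim V)) : simple_module V ->
  @casimir_mx V V X = (\tr X / (mod_dim V)%:R)%:M.
Proof.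
move=> Vs; have [a Ea] := schur_scalar Vs (@casimir_intertwines V V X).
rewrite Ea; congr _%:M; apply: canRL (mulfK (simple_dim_neq0 Vs)) _.
rewrite mulr_natr -mxtrace_scalar -Ea raddf_sum /=.
under eq_bigr => i _ do rewrite mxtrace_mulC mulmxA -lmodM.
by rewrite -raddf_sum -mulmx_suml /= -raddf_sum /= tf_sum1 lmod1 mul1mx.
Qed.

(** (dim V) times this element is the central idempotent of the block of a simple
    module V; it represents the character of V for the trace pairing. *)
Definition block_elt V : A := \sum_i character V (e i) *: e' i.

Lemma trace_block_elt V x : t (x * block_elt V) = character V x.
Proof.
rewrite mulr_sumr raddf_sum /= [in RHS](tf_expand T x) raddf_sum /=.
by apply: eq_bigr => i _; rewrite -scalerAr !linearZ /= mulrC.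
Qed.

(** The orthogonality relations between matrix entries: each entry of the action
    of block_elt on W is read off from averages of matrix units. *)
Lemma block_elt_entry V W k l :
  W (block_elt V) k l =
  \sum_m @casimir_mx W V (delta_mx m k) m l.
Proof.
rewrite raddf_sum summxE /=.
under [RHS]eq_bigr => m _ do rewrite summxE.
rewrite exchange_big; apply: eq_bigr => i _ /=.
rewrite linearZ /= mxE /character /mxtrace mulr_suml; apply: eq_bigr => m _.
rewrite mxE (bigD1 k) //= big1 => [|j jk]; rewrite mxE (bigD1 m) //= big1 => [|n nm].
- by rewrite mxE !eqxx mulr1 !addr0.
- by rewrite mxE (negbTE nm) mulr0.
- by rewrite mxE (negbTE jk) andbF mulr0 addr0 mul0r.
- by rewrite mxE (negbTE nm) mulr0.
Qed.

Lemma block_elt_neq V W : simple_module V -> simple_module W ->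
  ~ module_equiv V W -> W (block_elt V) = 0.
Proof.
move=> Vs Ws VW; apply/matrixP => k l; rewrite block_elt_entry mxE big1 // => m _.
by rewrite casimir_neq ?mxE // => /module_equiv_sym.
Qed.

Lemma block_elt_eq V : simple_module V ->
  V (block_elt V) = ((mod_dim V)%:R^-1)%:M.
Proof.
move=> Vs; apply/matrixP => k l; rewrite block_elt_entry.
rewrite (bigD1 k) //= big1 => [|m mk].
  by rewrite casimir_eq // mxtrace_delta eqxx mul1r addr0.
by rewrite casimir_eq // mxE mxtrace_delta (negbTE mk) mul0r mul0rn.
Qed.

Lemma block_elt_equiv V W : simple_module V -> module_equiv V W ->
  W (block_elt V) = ((mod_dim V)%:R^-1)%:M.
Proof.
move=> Vs [f [g [fg gf fV]]].
rewrite -[LHS]mulmx1 -fg mulmxA -fV block_elt_eq // mul_mx_scalar -scalemxAl fg.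
by rewrite scalemx1.
Qed.

Lemma casimir2_simple V : simple_module V ->
  V (casimir2 T) = ((mod_dim V)%:R^-2)%:M.
Proof.
move=> Vs; have d0 := simple_dim_neq0 Vs.
transitivity ((mod_dim V)%:R^-1 *: V (block_elt V)); last first.
  by rewrite block_elt_eq // scale_scalar_mx -expr2 exprVn.
rewrite /casimir2 exchange_big /block_elt /= !raddf_sum /=; apply: eq_bigr => j _.
transitivity (@casimir_mx V V (V (e j)) *m V (e' j)).
  rewrite raddf_sum /= mulmx_suml; apply: eq_bigr => i _.
  by rewrite !lmodM.
by rewrite casimir_eq // mul_scalar_mx linearZ /= scalerA mulrC.
Qed.

(** Both sides have coefficients on the dual basis given by the character of V,
    at e_k a and at a e_k. *)
Lemma block_elt_central V a : a * block_elt V = block_elt V * a.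
Proof.
rewrite mulr_sumr mulr_suml.
transitivity (\sum_k character V (e k * a) *: e' k).
  transitivity (\sum_j \sum_k (character V (e j) * t (a * e' j * e k)) *: e' k).
    apply: eq_bigr => j _; rewrite -scalerAr [in LHS](tf_expand_dual T (a * e' j)).
    by rewrite scaler_sumr; apply: eq_bigr => k _; rewrite scalerA.
  rewrite exchange_big; apply: eq_bigr => k _ /=; rewrite -scaler_suml.
  congr (_ *: _); rewrite [in RHS](tf_expand T (e k * a)) raddf_sum /=.
  by apply: eq_bigr => j _; rewrite linearZ /= mulrC tf_traceC mulrA.
transitivity (\sum_j \sum_k (character V (e j) * t (e' j * a * e k)) *: e' k).
  rewrite exchange_big; apply: eq_bigr => k _ /=; rewrite -scaler_suml.
  congr (_ *: _); rewrite characterC [in LHS](tf_expand T (a * e k)) raddf_sum /=.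
  by apply: eq_bigr => j _; rewrite linearZ /= mulrC tf_traceC mulrA.
apply: eq_bigr => j _; rewrite -scalerAl [in RHS](tf_expand_dual T (e' j * a)).
by rewrite scaler_sumr; apply: eq_bigr => k _; rewrite scalerA.
Qed.

(** Products of block elements cannot be compared through their actions on simple
    modules, which are not yet known to separate the elements of the algebra; the
    nondegenerate trace is used instead. *)
Lemma block_elt_mul V W : simple_module V -> simple_module W ->
  ~ module_equiv V W -> block_elt V * block_elt W = 0.
Proof.
move=> Vs Ws VW; apply: (tf_nondeg (T := T)) => y.
by rewrite mulrA trace_block_elt /character lmodM block_elt_neq // mulmx0 mxtrace0.
Qed.

Lemma block_elt_idem V : simple_module V ->
  block_elt V * block_elt V = (mod_dim V)%:R^-1 *: block_elt V.
Proof.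
move=> Vs; apply/eqP; rewrite -subr_eq0; apply/eqP/(tf_nondeg (T := T)) => y.
rewrite mulrBr linearB /= mulrA trace_block_elt /character lmodM block_elt_eq //.
by rewrite mul_mx_scalar -scalerAr !linearZ /= trace_block_elt subrr.
Qed.

End Casimir.

(** * Left ideals as modules, and the completeness of the simple modules *)

Section LeftIdealModule.
Variables (F : fieldType) (A : falgType F) (L : {vspace A}).
Hypothesis Lstable : forall a x, x \in L -> a * x \in L.
Local Notation n := (\dim L).
Local Notation b := (vbasis L).

(** Left multiplication on the left ideal L, in the coordinates of a basis of L. *)
Definition ideal_act (a : A) : 'M[F]_n := \matrix_(k, l) coord b k (a * b`_l).

Definition ideal_vec (v : 'cV[F]_n) : A := \sum_k v k 0 *: b`_k.

Lemma ideal_vec_mem v : ideal_vec v \in L.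
Proof.
rewrite rpred_sum // => k _; rewrite rpredZ //.
by apply: vbasis_mem; rewrite mem_nth ?size_tuple.
Qed.

Lemma ideal_vec_inj : injective ideal_vec.
Proof.
move=> u v Euv; apply/colP => k.
have coordE w : coord b k (ideal_vec w) = w k 0.
  rewrite coord_sum_free //; exact: basis_free (vbasisP L).
by rewrite -coordE Euv coordE.
Qed.

Lemma ideal_vec_surj x : x \in L -> exists v, x = ideal_vec v.
Proof.
move=> xL; exists (\col_k coord b k x); rewrite [LHS](coord_vbasis xL).
by apply: eq_bigr => k _; rewrite mxE.
Qed.

Lemma ideal_actE a v : ideal_vec (ideal_act a *m v) = a * ideal_vec v.
Proof.
rewrite mulr_sumr [RHS](eq_bigr (fun l => v l 0 *: (a * b`_l))); last first.
  by move=> l _; rewrite -scalerAr.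
under [RHS]eq_bigr => l _.
  have abL : a * b`_l \in L.
    by rewrite Lstable // vbasis_mem // mem_nth ?size_tuple.
  rewrite (coord_vbasis abL) scaler_sumr.
  under eq_bigr => k _ do rewrite scalerA.
  over.
rewrite exchange_big; apply: eq_bigr => k _ /=.
rewrite -scaler_suml mxE; congr (_ *: _).
by apply: eq_bigr => l _; rewrite mxE mulrC.
Qed.

Lemma ideal_act_eq (X Y : 'M[F]_n) :
  (forall v, ideal_vec (X *m v) = ideal_vec (Y *m v)) -> X = Y.
Proof.
move=> XY; apply/trmx_inj/row_matrixP => i.
by rewrite -!tr_col !colE (ideal_vec_inj (XY _)).
Qed.

Lemma ideal_vec_linear : linear ideal_vec.
Proof.
move=> c u v; rewrite scaler_sumr -big_split; apply: eq_bigr => k _ /=.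
by rewrite !mxE scalerDl scalerA.
Qed.

Lemma ideal_act_linear : linear ideal_act.
Proof.
move=> c x y; apply: ideal_act_eq => v.
rewrite mulmxDl -scalemxAl ideal_vec_linear !ideal_actE.
by rewrite mulrDl scalerAl.
Qed.

Lemma ideal_act_monoid : monoid_morphism ideal_act.
Proof.
split; first by apply: ideal_act_eq => v; rewrite ideal_actE mul1r mul1mx.
by move=> x y; apply: ideal_act_eq => v; rewrite -mulmxA !ideal_actE mulrA.
Qed.

HB.instance Definition _ := GRing.isSemilinear.Build F A 'M[F]_n *:%R ideal_act
  (GRing.semilinear_linear ideal_act_linear).
HB.instance Definition _ :=
  GRing.isMonoidMorphism.Build A 'M[F]_n ideal_act ideal_act_monoid.

HB.instance Definition _ := GRing.isSemilinear.Build F 'cV[F]_n A *:%R ideal_vec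
  (GRing.semilinear_linear ideal_vec_linear).

Definition ideal_module : lmodule A := LModule ideal_act.

Hypothesis Lneq0 : L != 0%VS.
Hypothesis Lmin : forall K : {vspace A}, (K <= L)%VS ->
  (forall a x, x \in K -> a * x \in K) -> K = 0%VS \/ K = L.

Lemma ideal_module_simple : simple_module ideal_module.
Proof.
split; first by rewrite lt0n dimv_eq0.
move=> U Ustable.
pose iv := linfun ideal_vec.
have ivE v : iv v = ideal_vec v by rewrite lfunE.
have memK v : (ideal_vec v \in (iv @: U)%VS) = (v \in U).
  apply/memv_imgP/idP => [[u uU]|vU]; last by exists v; rewrite ?ivE.
  by rewrite ivE => /ideal_vec_inj->.
have [||K0|KL] := Lmin (K := (iv @: U)%VS).
- by apply/subvP => _ /memv_imgP[u _ ->]; rewrite ivE ideal_vec_mem.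
- move=> a _ /memv_imgP[u uU ->].
  by rewrite ivE -ideal_actE memK Ustable.
- left; apply/eqP; rewrite -subv0; apply/subvP => v.
  rewrite -memK K0 !memv0 => /eqP v0; apply/eqP/ideal_vec_inj.
  by rewrite v0 -ivE linear0.
- right; apply/eqP; rewrite eqEsubv subvf /=; apply/subvP => v _.
  by rewrite -memK KL ideal_vec_mem.
Qed.

End LeftIdealModule.

Section MinimalIdeal.
Variables (F : fieldType) (A : falgType F).

Definition left_stable (L : {vspace A}) : Prop :=
  forall a x, x \in L -> a * x \in L.

Lemma minimal_left_ideal (L : {vspace A}) : left_stable L -> L != 0%VS ->
  exists K : {vspace A}, [/\ (K <= L)%VS, left_stable K, K != 0%VS &
    forall K' : {vspace A}, (K' <= K)%VS -> left_stable K' -> K' = 0%VS \/ K' = K].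
Proof.
elim: {L}(\dim L).+1 {-2}L (ltnSn (\dim L)) => // m IHm L dimL Lst L0.
have [Lmin|] := pselect (forall K : {vspace A},
  (K <= L)%VS -> left_stable K -> K = 0%VS \/ K = L); first by exists L; split.
move/existsNP=> [K /not_implyP[KL /not_implyP[Kst /not_orP[K0 KneL]]]].
have [|||K' [K'K K'st K'0 K'min]] := IHm K => //; last first.
- by exists K'; split=> //; exact: subv_trans KL.
- exact/eqP.
- rewrite -ltnS; apply: leq_trans dimL; rewrite ltnS ltn_neqAle dimvS // andbT.
  by apply/eqP => dimE; case: KneL; apply/eqP; rewrite eqEdim KL dimE /=.
Qed.

End MinimalIdeal.

Section SimpleFamily.
Variables (F : numClosedFieldType) (A : falgType F) (T : trace_form A).

Definition inequivalent_simples n (V : 'I_n -> lmodule A) : Prop :=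
  (forall i, simple_module (V i)) /\
  (forall i j, module_equiv (V i) (V j) -> i = j).

Definition complete_simples n (V : 'I_n -> lmodule A) : Prop :=
  inequivalent_simples V /\
  (forall M, simple_module M -> exists i, module_equiv (V i) M).

(** The block elements of inequivalent simple modules are linearly independent. *)
Lemma inequivalent_simples_bound n (V : 'I_n -> lmodule A) :
  inequivalent_simples V -> (n <= \dim {:A})%N.
Proof.
case=> Vs Vne; pose X := [tuple block_elt T (V i) | i < n].
suff freeX : free X by rewrite -[n](size_tuple X) -(eqP freeX) dimvS ?subvf.
apply/freeP => k k0 i.
have := congr1 (V i) k0; rewrite raddf0 raddf_sum (bigD1 i) //= big1 => [|j ji].
  rewrite nth_mktuple linearZ /= block_elt_eq // addr0 scale_scalar_mx.
  pose o := Ordinal (Vs i).1.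
  move=> /matrixP/(_ o o)/eqP; rewrite !mxE eqxx mulr1n.
  by rewrite mulf_eq0 invr_eq0 (negbTE (simple_dim_neq0 (Vs i))) orbF => /eqP.
rewrite nth_mktuple linearZ /= block_elt_neq ?scaler0 // => /Vne/eqP.
by rewrite (negbTE ji).
Qed.

Lemma complete_simples_exist : exists n (V : 'I_n -> lmodule A), complete_simples V.
Proof.
pose P n := `[< exists V : 'I_n -> lmodule A, inequivalent_simples V >].
have P0 : exists n, P n.
  exists 0%N; apply/asboolP.
  by exists (fun _ => ideal_module (fun a x _ => memvf (a * x))); split=> -[].
have [|n /asboolP[V [Vs Vne]] nmax] := ex_maxnP P0 (m := \dim {:A}).
  by move=> n /asboolP[V]; exact: inequivalent_simples_bound.
exists n, V; split=> // M Ms; apply: contrapT => /forallNP Mne.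
suff /nmax : P n.+1 by rewrite ltnn.
apply/asboolP; exists (fun i => if unlift ord0 i is Some j then V j else M).
split=> [i | i j]; first by case: unliftP.
case: unliftP => [i' ->|->]; case: unliftP => [j' ->|->] //.
- by move=> /Vne->.
- by move=> /Mne.
- by move=> /module_equiv_sym/Mne.
Qed.

Variables (n : nat) (V : 'I_n -> lmodule A).
Hypothesis VC : complete_simples V.
Let Vs := VC.1.1.
Let Vne := VC.1.2.

(** The complement u of the sum of the block idempotents is a central idempotent
    that kills every simple module.  If u were nonzero, a minimal left ideal
    inside the ideal generated by u would be a simple module on which u acts as
    the identity. *)
Lemma sum_block_elt : 1 = \sum_i (mod_dim (V i))%:R *: block_elt T (V i).
Proof.
have d0 i : (mod_dim (V i))%:R != 0 :> F by exact: simple_dim_neq0.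
pose u := 1 - \sum_i (mod_dim (V i))%:R *: block_elt T (V i).
suff /eqP : u = 0 by rewrite subr_eq0 => /eqP.
have uC a : a * u = u * a.
  rewrite mulrBr mulrBl mulr1 mul1r mulr_sumr mulr_suml; congr (_ - _).
  by apply: eq_bigr => i _; rewrite -scalerAr block_elt_central scalerAl.
have uK i : u * block_elt T (V i) = 0.
  rewrite mulrBl mul1r mulr_suml (bigD1 i) //= big1 => [|j ji].
    by rewrite addr0 -scalerAl block_elt_idem // scalerA mulfV // scale1r subrr.
  rewrite -scalerAl block_elt_mul ?scaler0 //.
  by move=> /Vne/eqP; rewrite (negbTE ji).
have uu : u * u = u.
  rewrite {2}/u mulrBr mulr1 mulr_sumr big1 ?subr0 // => i _.
  by rewrite -scalerAr uK scaler0.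
have uM M : simple_module M -> M u = 0.
  move=> Ms; have [i Mi] := VC.2 M Ms.
  rewrite raddfB /= lmod1 raddf_sum (bigD1 i) //= big1 => [|j ji].
    by rewrite linearZ /= (block_elt_equiv T (Vs i) Mi) scale_scalar_mx mulfV // addr0 subrr.
  rewrite linearZ /= block_elt_neq ?scaler0 // => Mj.
  have /Vne/eqP := module_equiv_trans Mj (module_equiv_sym Mi).
  by rewrite (negbTE ji).
apply: contrapT => /eqP u0.
pose L := limg (amull u).
have memL x : (x \in L) = (u * x == x).
  apply/memv_imgP/eqP => [[y _ ->]|ux]; first by rewrite lfunE /= mulrA uu.
  by exists x; rewrite ?memvf // lfunE /= ux.
have Lst : left_stable L.
  by move=> a x; rewrite !memL => /eqP ux; rewrite mulrA -uC -mulrA ux.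
have L0 : L != 0%VS.
  apply: contraNneq u0 => L0; have : u \in L by rewrite memL uu.
  by rewrite L0 memv0.
have [K [KL Kst K0 Kmin]] := minimal_left_ideal Lst L0.
have Ms : simple_module (ideal_module Kst) by exact: ideal_module_simple.
have := uM _ Ms; set M := ideal_module Kst => Mu0.
case/eqP: K0; apply/eqP; rewrite -subv0; apply/subvP => x xK.
have := subvP KL x xK; rewrite memL memv0 => /eqP <-.
have [v ->] := ideal_vec_surj xK.
by rewrite -(ideal_actE Kst) [ideal_act _ _]Mu0 mul0mx linear0.
Qed.

(** The decomposition of the regular representation, at the level of traces. *)
Lemma trace_formula x : tf_trace T x = \sum_i (mod_dim (V i))%:R * character (V i) x.
Proof.
rewrite -[in LHS](mulr1 x) sum_block_elt mulr_sumr raddf_sum /=.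
by apply: eq_bigr => i _; rewrite -scalerAr linearZ /= trace_block_elt.
Qed.

End SimpleFamily.

(** * Counting simple modules of dimension prime to p by a trace *)

Section Sieve.
Variable p : nat.

(** A polynomial q that keeps the eigenvalue d^-2 of casimir2 when d is prime to p
    and kills it otherwise.  It has rational coefficients so that its values on
    casimir2 stay rational in a group algebra. *)
Definition sieve (ds : seq nat) (q : {poly rat}) : Prop :=
  forall d, d \in ds -> (0 < d)%N ->
    q.[d%:R ^- 2] = if coprime d p then d%:R ^- 2 else 0.

Lemma sieve_exists ds : exists q, sieve ds q.
Proof.
elim: ds => [|d ds [q qds]]; first by exists 0.
have [dds|dds] := boolP (d \in ds).
  by exists q => d'; rewrite inE => /predU1P[->|]; exact: qds.
have [->|d0] := posnP d.
  by exists q => d'; rewrite inE => /predU1P[->|] //; exact: qds.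
(* Lagrange interpolation: r vanishes at the nodes already treated. *)
pose r := \prod_(d' <- [seq d' <- ds | (0 < d')%N]) ('X - (d'%:R ^- 2)%:P) : {poly rat}.
have rE d' : (0 < d')%N -> (r.[d'%:R ^- 2] == 0) = (d' \in ds).
  move=> d'0; rewrite /r -(big_map (fun d' => d'%:R ^- 2) predT (fun a => 'X - a%:P)).
  rewrite -rootE root_prod_XsubC; apply/mapP/idP => [[d'']|d'ds].
    rewrite mem_filter => /andP[d''0 d''ds] /invr_inj/eqP.
    by rewrite eqrXn2 ?ler0n // eqr_nat => /eqP->.
  by exists d' => //; rewrite mem_filter d'0.
pose a := d%:R ^- 2 : rat.
exists (q + (((if coprime d p then a else 0) - q.[a]) / r.[a]) *: r) => d'.
rewrite inE hornerD hornerZ => /predU1P[->|d'ds] d'0.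
  rewrite -/a divfK; last by rewrite rE.
  by rewrite addrCA subrr addr0.
have /eqP -> : r.[d'%:R ^- 2] == 0 by rewrite rE.
by rewrite mulr0 addr0 qds.
Qed.

Lemma sieve_sub ds ds' q : {subset ds <= ds'} -> sieve ds' q -> sieve ds q.
Proof. by move=> s qs d /s; exact: qs. Qed.

End Sieve.

Section CountSimples.
Variables (F : numClosedFieldType) (A : falgType F) (T : trace_form A).
Variables (n : nat) (V : 'I_n -> lmodule A).
Hypothesis VC : complete_simples V.

(** The class of a simple module is the set of the modules equivalent to it, so
    that distinct indices of a complete family give distinct classes. *)
Lemma mu_card p : mu A p = #|[set i | coprime (mod_dim (V i)) p]|.
Proof.
pose f i : classical_sets.set (lmodule A) := module_equiv (V i).
have fE M i : module_equiv (V i) M -> module_equiv M = f i :> classical_sets.set (lmodule A).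
  move=> iM; apply/funext => N; apply/propext; split.
    exact: module_equiv_trans.
  exact/module_equiv_trans/module_equiv_sym.
have f_inj : injective f.
  move=> i j fij; apply: VC.1.2.
  have -> : module_equiv (V i) (V j) = f i (V j) by [].
  by rewrite fij; exact: module_equiv_refl.
have -> : mu A p = #|` [fset f i | i in [set i | coprime (mod_dim (V i)) p]]%fset|.
  rewrite /mu -[RHS](congr1 (fun S => #|` S|%fset) (cardinality.set_fsetK _)).
  congr (#|` cardinality.fset_set _|%fset); apply/classical_sets.seteqP.
  split=> [_ [M [Ms Mp] <-]|S].
    have [i iM] := VC.2 M Ms; rewrite (fE _ _ iM); apply/imfsetP; exists i => //=.
    by rewrite inE (module_equiv_dim iM).
  move=> /imfsetP[i /=]; rewrite inE => ip ->; exists (V i) => //; split=> //.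
  exact: VC.1.1.
by rewrite card_imfset // cardE.
Qed.

Definition casimir_poly (q : {poly rat}) : A :=
  horner_alg (casimir2 T) (map_poly ratr q).

Lemma module_horner (M : lmodule A) (x : A) (a : F) (q : {poly F}) :
  M x = a%:M -> M (horner_alg x q) = q.[a]%:M.
Proof.
move=> Mx; elim/poly_ind: q => [|q c IHq].
  by rewrite rmorph0 raddf0 horner0 raddf0.
rewrite rmorphD rmorphM /= horner_algX horner_algC raddfD /= lmodM IHq Mx.
rewrite linearZ /= lmod1 scalemx1 hornerMXaddC -scalar_mxM.
by rewrite -raddfD.
Qed.

Lemma casimir_poly_simple q M : simple_module M ->
  M (casimir_poly q) = (ratr q.[(mod_dim M)%:R ^- 2])%:M.
Proof.
move=> Ms; rewrite (module_horner _ (casimir2_simple T Ms)).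
by rewrite -horner_map /= fmorphV rmorphXn /= ratr_nat.
Qed.

Lemma trace_casimir_poly q y :
  tf_trace T (casimir_poly q * y) = \sum_i (mod_dim (V i))%:R *
    ratr q.[(mod_dim (V i))%:R ^- 2] * character (V i) y.
Proof.
rewrite (trace_formula T VC); apply: eq_bigr => i _.
rewrite /character lmodM casimir_poly_simple; last exact: VC.1.1.
by rewrite mul_scalar_mx linearZ /= mulrA.
Qed.

Definition simple_dims : seq nat := [seq mod_dim (V i) | i <- enum 'I_n].

(** The linear form whose value at a central idempotent is the number of simple
    modules, of dimension prime to p, on which the idempotent acts as 1. *)
Definition p'_character p (y : A) : F :=
  \sum_(i | coprime (mod_dim (V i)) p) character (V i) y / (mod_dim (V i))%:R.

Lemma trace_sieve p q y : sieve p simple_dims q ->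
  tf_trace T (casimir_poly q * y) = p'_character p y.
Proof.
move=> qs; rewrite trace_casimir_poly [RHS]big_mkcond; apply: eq_bigr => i _ /=.
have d0 : (mod_dim (V i))%:R != 0 :> F by apply: simple_dim_neq0; exact: VC.1.1.
rewrite qs; last 2 first.
- by apply/mapP; exists i; rewrite ?mem_enum.
- exact: (VC.1.1 i).1.
case: ifP => _; last by rewrite rmorph0 mulr0 mul0r.
by rewrite fmorphV rmorphXn /= ratr_nat expr2 invfM mulrA mulfV // mul1r mulrC.
Qed.

Lemma p'_character1 p : p'_character p 1 = (mu A p)%:R.
Proof.
rewrite mu_card cardsE -sum1_card natr_sum; apply: eq_bigr => i _.
by rewrite character1 divff //; apply: simple_dim_neq0; exact: VC.1.1.
Qed.

End CountSimples.

(** * Group algebras *)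

Section GroupAlgebraForm.
Variables (F : numClosedFieldType) (gT : finGroupType).
Local Notation FG := (group_alg F gT).

Definition gbasis (g : gT) : FG := basis_elt F g.

Lemma gbasisM g h : gbasis g * gbasis h = gbasis (g * h)%g.
Proof. exact: bilinear_ext_basis. Qed.

Lemma gbasis1 : gbasis 1%g = 1. Proof. by []. Qed.

Lemma gbasisE g h : gbasis g h = (h == g)%:R.
Proof. by rewrite ffunE. Qed.

Lemma gbasis_expand (y : FG) : y = \sum_g y g *: gbasis g.
Proof. exact: basis_eltE. Qed.

Lemma gcoefD (x y : FG) g : (x + y) g = x g + y g.
Proof. by rewrite ffunE. Qed.

Lemma gcoefZ a (x : FG) g : (a *: x) g = a * x g.
Proof. by rewrite ffunE. Qed.

Lemma gcoef_sum (I : Type) (r : seq I) P (f : I -> FG) g :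
  (\sum_(i <- r | P i) f i) g = \sum_(i <- r | P i) f i g.
Proof.
by apply: (big_morph (fun y : FG => y g)) => [x y|]; rewrite ?gcoefD ?ffunE.
Qed.

Lemma gcoef_mull h (y : FG) g : (gbasis h * y) g = y (h^-1 * g)%g.
Proof.
rewrite [in LHS](gbasis_expand y) mulr_sumr gcoef_sum (bigD1 (h^-1 * g)%g) //=.
rewrite big1 => [|k kg]; rewrite -scalerAr gcoefZ gbasisM gbasisE.
  by rewrite mulKVg eqxx mulr1 addr0.
case: eqP => [gE|]; last by rewrite mulr0.
by case/eqP: kg; rewrite gE mulKg.
Qed.

Lemma gcoef_mul (x y : FG) g : (x * y) g = \sum_h x h * y (h^-1 * g)%g.
Proof.
rewrite [in LHS](gbasis_expand x) mulr_suml gcoef_sum; apply: eq_bigr => h _.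
by rewrite -scalerAl gcoefZ gcoef_mull.
Qed.

Definition group_trace (y : FG) : F := #|gT|%:R * y 1%g.

Lemma group_trace_is_scalar : scalar group_trace.
Proof.
by move=> a x y; rewrite /group_trace gcoefD gcoefZ mulrDr mulrCA.
Qed.
HB.instance Definition _ := GRing.isSemilinear.Build F FG F *%R group_trace
  (GRing.semilinear_linear group_trace_is_scalar).

Lemma group_traceC x y : group_trace (x * y) = group_trace (y * x).
Proof.
congr (_ * _); rewrite !gcoef_mul (reindex_inj invg_inj) /=.
by apply: eq_bigr => h _; rewrite invgK !mulg1 mulrC.
Qed.

Lemma cardT_neq0 : #|gT|%:R != 0 :> F.
Proof. by rewrite pnatr_eq0 -lt0n -cardsT cardG_gt0. Qed.

Definition gdual (g : gT) : FG := #|gT|%:R^-1 *: gbasis g^-1.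

Lemma group_trace_gbasis g : group_trace (gbasis g) = (#|gT| * (g == 1%g))%:R.
Proof. by rewrite /group_trace gbasisE eq_sym natrM. Qed.

Lemma group_orth g h : group_trace (gbasis g * gdual h) = (g == h)%:R.
Proof.
rewrite -scalerAr linearZ /= gbasisM group_trace_gbasis -eq_mulgV1 natrM mulrA.
by rewrite mulVf ?mul1r ?cardT_neq0.
Qed.

Lemma group_expand x : x = \sum_g group_trace (x * gdual g) *: gbasis g.
Proof.
rewrite [LHS]gbasis_expand; apply: eq_bigr => g _; congr (_ *: _).
rewrite [in RHS](gbasis_expand x) mulr_suml raddf_sum (bigD1 g) //= big1.
  by rewrite -scalerAl linearZ /= group_orth eqxx mulr1 addr0.
by move=> h hg; rewrite -scalerAl linearZ /= group_orth (negbTE hg) mulr0.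
Qed.

Lemma group_sum1 : \sum_g gdual g * gbasis g = 1.
Proof.
under eq_bigr => g _ do rewrite -scalerAl gbasisM mulVg gbasis1.
by rewrite sumr_const -scaler_nat scalerA mulfV ?cardT_neq0 ?scale1r.
Qed.

Definition group_form : trace_form FG :=
  TraceForm group_traceC group_expand group_orth group_sum1.

(** In a group algebra the double average is the mean of all commutators; this
    is what makes it compatible with group homomorphisms. *)
Lemma casimir2_group : casimir2 group_form =
  #|gT|%:R ^- 2 *: \sum_a \sum_b gbasis (a * b * a^-1 * b^-1)%g.
Proof.
rewrite /casimir2 scaler_sumr; apply: eq_bigr => a _ /=.
rewrite scaler_sumr; apply: eq_bigr => b _ /=.
rewrite /gdual -!scalerAr -scalerAl scalerA !gbasisM.
by rewrite expr2 invfM.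
Qed.

End GroupAlgebraForm.

Section Lift.
Variables (F : numClosedFieldType) (gT : finGroupType) (A : falgType F).
Variable phi : gT -> A.

Definition glift (y : group_alg F gT) : A := \sum_g y g *: phi g.

Lemma glift_is_linear : linear glift.
Proof.
move=> a x y; rewrite scaler_sumr -big_split; apply: eq_bigr => g _ /=.
by rewrite gcoefD gcoefZ scalerDl scalerA.
Qed.
HB.instance Definition _ := GRing.isSemilinear.Build F (group_alg F gT) A *:%R glift
  (GRing.semilinear_linear glift_is_linear).

Lemma glift_gbasis g : glift (gbasis F g) = phi g.
Proof.
rewrite /glift (bigD1 g) //= big1 => [|h hg]; rewrite gbasisE.
  by rewrite eqxx scale1r addr0.
by rewrite (negbTE hg) scale0r.
Qed.

Hypothesis phiM : forall g h, phi (g * h)%g = phi g * phi h.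

Lemma gliftM x y : glift (x * y) = glift x * glift y.
Proof.
rewrite (gbasis_expand x) mulr_suml !raddf_sum mulr_suml; apply: eq_bigr => g _ /=.
rewrite (gbasis_expand y) mulr_sumr !raddf_sum mulr_sumr; apply: eq_bigr => h _ /=.
rewrite -scalerAl -scalerAr !linearZ /= gbasisM !glift_gbasis phiM.
by rewrite -scalerAl -scalerAr.
Qed.

End Lift.

(** Intertwining passes from z to polynomials in z, for a map phi that need not be
    unital; for an embedding into a corner of A, it is not. *)
Lemma horner_alg_transfer (F : fieldType) (A B : falgType F)
  (phi : {linear B -> A}) (z : A) (y : B) (q : {poly F}) :
  (forall b, z * phi b = phi (y * b)) ->
  forall b, horner_alg z q * phi b = phi (horner_alg y q * b).
Proof.
move=> zphi; elim/poly_ind: q => [|q c IHq] b.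
  by rewrite !rmorph0 !mul0r raddf0.
rewrite !rmorphD !rmorphM /= !horner_algX !horner_algC !mulrDl -!mulrA zphi IHq.
by rewrite raddfD /= -!scalerAl !mul1r linearZ.
Qed.

(** * Traces along surjective homomorphisms *)

Section FibreSums.
Variables (hT kT : finGroupType) (f : hT -> kT).
Hypothesis fM : forall a b, f (a * b)%g = (f a * f b)%g.

Lemma hom1 : f 1%g = 1%g.
Proof. by apply: (mulgI (f 1%g)); rewrite -fM !mulg1. Qed.

Lemma homV a : f a^-1%g = (f a)^-1%g.
Proof. by apply: (mulgI (f a)); rewrite -fM !mulgV hom1. Qed.

(** All the nonempty fibres are cosets of the kernel. *)
Lemma sum_hom (U : nmodType) (u : kT -> U) :
  \sum_a u (f a) = (\sum_(c in f @: [set: hT]) u c) *+ #|[set a | f a == 1%g]|.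
Proof.
rewrite (partition_big f (mem (f @: [set: hT]))) /= => [|a _]; last exact: imset_f.
rewrite -sumrMnl; apply: eq_bigr => _ /imsetP[a _ ->].
rewrite (eq_bigr (fun=> u (f a))) => [|b /eqP-> //]; rewrite sumr_const; congr (_ *+ _).
rewrite -[RHS](card_imset _ (mulgI a)); apply: eq_card => b; rewrite -[LHS]/(f b == f a).
apply/eqP/imsetP => [fb|[k]].
  by exists (a^-1 * b)%g; rewrite ?mulKVg // inE fM homV fb mulVg.
by rewrite inE => /eqP fk ->; rewrite fM fk mulg1.
Qed.

Lemma card_hom : #|hT| = (#|f @: [set: hT]| * #|[set a | f a == 1%g]|)%N.
Proof.
have natE (x m : nat) : x *+ m = (x * m)%N.
  by elim: m => [|m IHm]; rewrite ?muln0 // mulrS IHm mulnS.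
by rewrite -natE -sum1_card -(@sum_hom nat (fun=> 1%N)) sum1_card.
Qed.

End FibreSums.

Section KernelAverage.
Variables (F : numClosedFieldType) (hT : finGroupType).

(** When s is a linear character of a subgroup K, this is the idempotent that
    projects onto the vectors on which each k in K acts as s k. *)
Definition twisted_average (K : {set hT}) (s : hT -> F) : group_alg F hT :=
  #|K|%:R^-1 *: \sum_(k in K) s k *: gbasis F k^-1.

Lemma group_trace_average K s y :
  group_trace (y * twisted_average K s) =
  #|hT|%:R / #|K|%:R * \sum_(k in K) s k * y k.
Proof.
rewrite group_traceC /group_trace -scalerAl gcoefZ mulr_suml gcoef_sum -mulrA.
congr (_ * (_ * _)); apply: eq_bigr => k _.
by rewrite -scalerAl gcoefZ gcoef_mull invgK mulg1.
Qed.

End KernelAverage.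

Section Inflation.
Variables (F : numClosedFieldType) (hT kT : finGroupType) (f : hT -> kT).
Hypothesis fM : forall a b, f (a * b)%g = (f a * f b)%g.
Hypothesis f_onto : forall c, exists a, f a = c.

(** A module of the quotient is a module of the whole group on which the kernel
    acts trivially, and the average over the kernel projects onto these. *)
Lemma inflation_trace q :
  tf_trace (group_form F kT) (casimir_poly (group_form F kT) q) =
  tf_trace (group_form F hT) (casimir_poly (group_form F hT) q *
    twisted_average [set a | f a == 1%g] (fun=> 1)).
Proof.
pose phi : {linear group_alg F hT -> group_alg F kT} :=
  glift (fun a => gbasis F (f a)).
have phiM a b : gbasis F (f (a * b)%g) = gbasis F (f a) * gbasis F (f b).
  by rewrite gbasisM fM.
have phiE a : phi (gbasis F a) = gbasis F (f a) by exact: glift_gbasis.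
have imf : f @: [set: hT] = [set: kT].
  apply/setP => c; rewrite inE; apply/imsetP.
  by have [a <-] := f_onto c; exists a; rewrite ?inE.
set K := [set a | _].
have cardE : #|hT| = (#|kT| * #|K|)%N by rewrite (card_hom fM) imf cardsT.
have K0 : #|K|%:R != 0 :> F.
  by apply: contraNneq (cardT_neq0 F hT) => K0; rewrite cardE natrM K0 mulr0.
have cas : phi (casimir2 (group_form F hT)) = casimir2 (group_form F kT).
  rewrite !casimir2_group linearZ /= (raddf_sum phi).
  transitivity (#|hT|%:R ^- 2 *: \sum_a \sum_b
      gbasis F (f a * f b * (f a)^-1 * (f b)^-1)%g).
    congr (_ *: _); apply: eq_bigr => a _; rewrite raddf_sum; apply: eq_bigr => b _ /=.
    by rewrite phiE !fM !(homV fM).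
  have inner a : \sum_b gbasis F (f a * f b * (f a)^-1 * (f b)^-1)%g =
      (\sum_(c in [set: kT]) gbasis F (f a * c * (f a)^-1 * c^-1)%g) *+ #|K|.
    by rewrite (sum_hom fM (fun c => gbasis F (f a * c * (f a)^-1 * c^-1)%g)) imf.
  rewrite (eq_bigr _ (fun a _ => inner a)).
  rewrite (sum_hom fM (fun d => (\sum_(c in [set: kT]) gbasis F (d * c * d^-1 * c^-1)%g) *+ #|K|)).
  rewrite imf sumrMnl -mulrnA -scaler_nat scalerA cardE !natrM exprMn invfM -mulrA.
  rewrite expr2 mulVf ?mulf_neq0 // mulr1; congr (_ *: _).
  by apply: eq_big => [a|a _]; rewrite ?inE //; apply: eq_bigl => b; rewrite inE.
have tr y : group_trace (phi y) = group_trace (y * twisted_average K (fun=> 1)).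
  rewrite group_trace_average /phi /glift raddf_sum /= cardE natrM mulfK // mulr_sumr.
  rewrite [RHS]big_mkcond; apply: eq_bigr => a _ /=.
  rewrite linearZ /= group_trace_gbasis inE.
  by case: eqP => _; rewrite ?muln1 ?muln0 ?mulr0 // mul1r mulrC.
rewrite /= -tr -[in LHS](mulr1 (casimir_poly _ q)).
have phi1 : 1 = phi 1 by rewrite -!gbasis1 phiE (hom1 fM).
rewrite {1}phi1 /casimir_poly (@horner_alg_transfer _ _ _ _ _ (casimir2 (group_form F hT))).
  by rewrite mulr1.
by move=> b; rewrite -cas -gliftM.
Qed.

End Inflation.

(** * Galois conjugacy of roots of unity *)

Section Galois.
Variable F : numClosedFieldType.
Local Notation toF := (map_poly (ratr : rat -> F)).
Local Notation Phi d := (map_poly (intr : int -> rat) 'Phi_d).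

(** z is a root of the product of the 'Phi_k for k dividing d; if it is a root of
    'Phi_k then z^k = 1, which forces k = d. *)
Lemma Cyclotomic_root d (z : F) : d.-primitive_root z -> root (toF (Phi d)) z.
Proof.
move=> z_prim; have d0 := prim_order_gt0 z_prim.
have PhiF k : toF (Phi k) = map_poly intr 'Phi_k.
  by rewrite -map_poly_comp; apply: eq_map_poly => a /=; rewrite ratr_int.
have prodF k : (0 < k)%N -> \prod_(j <- divisors k) toF (Phi j) = 'X^k - 1.
  move=> k0; transitivity (map_poly (intr : int -> F) ('X^k - 1)); last first.
    by rewrite rmorphB rmorph1 /= map_polyXn.
  by rewrite -(prod_Cyclotomic k0) rmorph_prod; apply: eq_bigr => j _; rewrite PhiF.
have rootX k : (root ('X^k - 1) z = (d %| k)%N).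
  by rewrite rootE !hornerE subr_eq0 -(prim_order_dvd z_prim).
have : root (\prod_(k <- divisors d) toF (Phi k)) z by rewrite prodF // rootX.
rewrite rootE horner_prod prodf_seq_eq0 => /hasP[k kd /= zk].
have k0 : (0 < k)%N by move: kd; rewrite -dvdn_divisors // => /dvdn_gt0->.
suff -> : d = k by [].
apply/eqP; rewrite eqn_dvd [(k %| d)%N]dvdn_divisors // kd andbT -rootX -prodF //.
rewrite rootE horner_prod prodf_seq_eq0; apply/hasP; exists k => //.
by rewrite -dvdn_divisors.
Qed.

(** The cyclotomic polynomial is irreducible over the rationals, being the
    minimal polynomial of an algebraic number y.  Irreducibility is expressed as
    divisibility by that minimal polynomial, through the roots y of the factors. *)
Lemma primitive_root_conj d (z z' : F) (q : {poly rat}) :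
  d.-primitive_root z -> d.-primitive_root z' -> root (toF q) z -> root (toF q) z'.
Proof.
move=> zP z'P qz; have d0 := prim_order_gt0 zP.
have [y yP] := C_prim_root_exists d0.
have [m [Em m_monic] m_dvd] := minCpolyP y.
have {Em} mE : m = Phi d.
  apply: (map_poly_inj (ratr : rat -> algC)).
  rewrite -Em (minCpoly_cyclotomic yP) -(Cintr_Cyclotomic yP) -map_poly_comp.
  by apply: eq_map_poly => a /=; rewrite ratr_int.
have m0 : m != 0 by rewrite monic_neq0.
have mz := Cyclotomic_root zP; have mz' := Cyclotomic_root z'P.
rewrite -mE in mz mz'.
pose g := gcdp q m.
have gz : root (toF g) z by rewrite gcdp_map root_gcd qz.
have /dvdpP[h mhg] : g %| m by exact: dvdp_gcdr.
have : root (map_poly (ratr : rat -> algC) m) y by rewrite m_dvd.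
rewrite mhg rmorphM rootM !m_dvd => /orP[m_h|m_g].
  have h0 : h != 0 by apply: contraNneq m0 => h0; rewrite mhg h0 mul0r.
  have g0 : g != 0 by apply: contraNneq m0 => g0; rewrite mhg g0 mulr0.
  (* The cofactor h takes up the whole of m, so that g is constant. *)
  have := dvdp_leq h0 m_h; rewrite mhg size_mul //.
  have : size g != 1%N.
    apply/negP => /size_poly1P[c c0 gc]; move: gz; rewrite gc map_polyC /=.
    by rewrite rootC fmorph_eq0 (negbTE c0).
  have : (0 < size g)%N by rewrite size_poly_gt0.
  by case: (size g) => [|[|k]] // _ _; rewrite addnS /= addnS -ltn_subRL subnn.
have /dvdpP[k ->] : m %| q by exact: dvdp_trans m_g (dvdp_gcdl _ _).
by rewrite rmorphM rootM mz' orbT.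
Qed.

End Galois.

Section Rationality.
Variables (F : numClosedFieldType) (gT : finGroupType).
Implicit Types x y : group_alg F gT.

Definition rational_coefs y : Prop := forall g, exists r : rat, y g = ratr r.

Lemma rational_coefsD x y :
  rational_coefs x -> rational_coefs y -> rational_coefs (x + y).
Proof.
by move=> xQ yQ g; have [a xg] := xQ g; have [b yg] := yQ g; exists (a + b);
  rewrite gcoefD xg yg rmorphD.
Qed.

Lemma rational_coefsZ r y : rational_coefs y -> rational_coefs (ratr r *: y).
Proof.
by move=> yQ g; have [b yg] := yQ g; exists (r * b); rewrite gcoefZ yg rmorphM.
Qed.

Lemma rational_coefs_sum (I : finType) (f : I -> group_alg F gT) :
  (forall i, rational_coefs (f i)) -> rational_coefs (\sum_i f i).
Proof.
move=> fQ; elim/big_rec: _ => [g|i x _]; last exact: rational_coefsD.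
by exists 0; rewrite ffunE rmorph0.
Qed.

Lemma rational_coefs_gbasis h : rational_coefs (gbasis F h).
Proof. by move=> g; exists (g == h)%:R; rewrite gbasisE ratr_nat. Qed.

Lemma rational_coefs_casimir q h :
  rational_coefs (casimir_poly (group_form F gT) q * gbasis F h).
Proof.
have := rational_coefs_gbasis h; move: (gbasis F h) => y.
rewrite /casimir_poly; elim/poly_ind: q y => [|q c IHq] y yQ.
  by rewrite !rmorph0 mul0r => g; exists 0; rewrite ffunE rmorph0.
rewrite !rmorphD !rmorphM /= map_polyX map_polyC horner_algX horner_algC mulrDl -mulrA.
apply: rational_coefsD; last by rewrite -scalerAl mul1r; exact: rational_coefsZ.
apply: IHq; rewrite casimir2_group -scalerAl.
have -> : #|gT|%:R ^- 2 = ratr (#|gT|%:R ^- 2) :> F.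
  by rewrite fmorphV rmorphXn /= ratr_nat.
apply: rational_coefsZ; rewrite mulr_suml; apply: rational_coefs_sum => a.
rewrite mulr_suml; apply: rational_coefs_sum => b g.
by rewrite gcoef_mull; exact: yQ.
Qed.

End Rationality.

(** * Sylow normalizers and central kernels *)

Section CentralKernel.
Variables (hT kT : finGroupType) (f : {morphism [set: hT] >-> kT}).
Variables (p : nat) (Q : {group hT}).
Hypothesis kerf : ('ker f \subset 'Z([set: hT]))%g.
Hypothesis sylQ : (p.-Sylow([set: hT]) Q)%g.

(** If f(a) normalizes f(Q) then Q^a lies in Q ker(f), where Q is a normal Sylow
    subgroup since the kernel is central; hence Q^a = Q. *)
Lemma morphim_norm_central_ker :
  (f @* 'N(Q) = 'N_(f @* [set: hT])(f @* Q))%g.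
Proof.
apply/eqP; rewrite eqEsubset subsetI morphimS ?subsetT //= morphim_norm //=.
apply/subsetP => _ /setIP[/morphimP[a _ _ ->] faN].
apply: mem_morphim; rewrite ?inE //.
pose M := (Q <*> 'ker f)%G.
have cQK : ('ker f \subset 'C(Q))%g.
  apply: subset_trans kerf _; rewrite (subset_trans (subsetIr _ _)) //.
  by rewrite centS ?subsetT.
have sylM : (p.-Sylow(M) Q)%g.
  by apply: pHall_subl sylQ; rewrite ?joing_subl ?subsetT.
have nQM : (Q <| M)%g.
  rewrite /normal joing_subl join_subG normG.
  exact: subset_trans cQK (cent_sub _).
rewrite (sub_normal_Hall sylM nQM) ?pgroupJ ?(pHall_pgroup sylQ) //.
have QaE : (f @* (Q :^ a) = f @* Q)%g.
  by rewrite morphimJ ?inE //; apply/normP.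
rewrite /M /= joingC norm_joinEl ?(subset_trans cQK (cent_sub _)) //.
rewrite -morphimK ?subsetT // -QaE morphimK ?subsetT //.
by rewrite mulg_subr.
Qed.

Lemma morphim_Sylow_central : (p.-Sylow(f @* [set: hT]) (f @* Q))%g.
Proof. by apply: morphim_pSylow; rewrite ?subsetT. Qed.

End CentralKernel.

(** * The projective McKay property *)

Section CentralCharacter.
Variables (F : numClosedFieldType) (gT : finGroupType) (c : gT).
Hypothesis cZ : c \in ('Z([set: gT]))%g.

(** The idempotent that projects onto the part of a module where the central
    element c acts as z. *)
Definition root_average (z : F) : group_alg F gT :=
  #[c]%g%:R^-1 *: \sum_(j < #[c]%g) z ^+ j *: gbasis F (c ^- j)%g.

Lemma gbasis_centralC h y : h \in ('Z([set: gT]))%g ->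
  y * gbasis F h = gbasis F h * y.
Proof.
case/setIP=> _ /centP hC; rewrite (gbasis_expand y) mulr_suml mulr_sumr.
apply: eq_bigr => g _; rewrite -scalerAl -scalerAr !gbasisM.
by rewrite hC // inE.
Qed.

Lemma root_averageC z y : y * root_average z = root_average z * y.
Proof.
rewrite -scalerAr -scalerAl mulr_sumr mulr_suml; congr (_ *: _).
apply: eq_bigr => j _; rewrite -scalerAr -scalerAl gbasis_centralC //.
by rewrite groupV groupX.
Qed.

Lemma order_neq0 : #[c]%g%:R != 0 :> F.
Proof. by rewrite pnatr_eq0 -lt0n order_gt0. Qed.

Variable z : F.
Hypothesis zn : z ^+ #[c]%g = 1.

Lemma gbasis_root_average : gbasis F c * root_average z = z *: root_average z.
Proof.
have [n nE] : exists n, #[c]%g = n.+1 by exists #[c]%g.-1; rewrite prednK ?order_gt0.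
rewrite -scalerAr scalerA mulrC -scalerA; congr (_ *: _).
pose u j : group_alg F gT := z ^+ j *: gbasis F (c ^- j)%g.
have un : u #[c]%g = u 0%N by rewrite /u zn expg_order invg1.
have shift : \sum_(j < #[c]%g) u j = \sum_(j < #[c]%g) u j.+1.
  by move: un; rewrite nE big_ord_recl big_ord_recr /= addrC => ->.
rewrite [in LHS]shift mulr_sumr scaler_sumr; apply: eq_bigr => j _.
by rewrite /u -scalerAr gbasisM scalerA -exprS expgSr invMg mulKVg.
Qed.

Lemma gbasis_root_averageX j :
  z ^+ j *: gbasis F (c ^- j)%g * root_average z = root_average z.
Proof.
have gX k : gbasis F (c ^+ k)%g * root_average z = z ^+ k *: root_average z.
  elim: k => [|k IHk]; first by rewrite expr0 scale1r gbasis1 mul1r.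
  rewrite expgS -gbasisM -mulrA IHk -scalerAr gbasis_root_average scalerA.
  by rewrite -exprSr.
by rewrite -scalerAl scalerAr -gX mulrA gbasisM mulVg gbasis1 mul1r.
Qed.

Lemma root_average_idem : root_average z * root_average z = root_average z.
Proof.
rewrite {1}/root_average -scalerAl mulr_suml.
under eq_bigr => j _ do rewrite gbasis_root_averageX.
by rewrite sumr_const card_ord -scaler_nat scalerA mulVf ?order_neq0 ?scale1r.
Qed.

(** The idempotent acts on each simple module by a scalar equal to 0 or 1. *)
Lemma p'_character_root_average n (V : 'I_n -> lmodule (group_alg F gT)) p :
  complete_simples V ->
  exists m : nat, p'_character V p (root_average z) = m%:R.
Proof.
move=> VC; have Vs := VC.1.1.
suff h i : exists b : bool, character (V i) (root_average z) / (mod_dim (V i))%:R = b%:R.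
  have [b bE] := fin_all_exists h.
  exists (\sum_(i | coprime (mod_dim (V i)) p) b i)%N; rewrite natr_sum.
  by apply: eq_bigr => i _; rewrite bE.
have [|a aE] := schur_scalar (Vs i) (X := V i (root_average z)).
  by move=> y; rewrite -!lmodM root_averageC.
have d0 := simple_dim_neq0 (Vs i).
have -> : character (V i) (root_average z) = a * (mod_dim (V i))%:R.
  by rewrite /character aE mxtrace_scalar mulr_natr.
rewrite mulfK //.
have : a%:M *m a%:M = a%:M :> 'M_(mod_dim (V i)) by rewrite -aE -lmodM root_average_idem.
rewrite -scalar_mxM => /matrixP/(_ (Ordinal (Vs i).1) (Ordinal (Vs i).1))/eqP.
rewrite !mxE eqxx !mulr1n -subr_eq0 -[X in _ - X]mulr1 -mulrBr mulf_eq0 subr_eq0.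
by case/orP=> /eqP->; [exists false | exists true].
Qed.

End CentralCharacter.

Section GaloisInvariance.
Variables (F : numClosedFieldType) (gT : finGroupType) (c : gT).
Hypothesis cZ : c \in ('Z([set: gT]))%g.
Variables (n : nat) (V : 'I_n -> lmodule (group_alg F gT)).
Hypothesis VC : complete_simples V.

(** As a function of z, the count is a polynomial with rational coefficients.  It
    takes the integral value m at z, and hence at every conjugate of z. *)
Lemma p'_character_conj p d (z z' : F) : (d %| #[c]%g)%N ->
  d.-primitive_root z -> d.-primitive_root z' ->
  p'_character V p (root_average c z) = p'_character V p (root_average c z').
Proof.
move=> dn zP z'P; have [q qV] := sieve_exists p (simple_dims V).
have z1 (y : F) : d.-primitive_root y -> y ^+ #[c]%g = 1.
  by move=> yP; apply/eqP; rewrite -(prim_order_dvd yP).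
have [m mE] := p'_character_root_average cZ (z1 z zP) p VC.
have /fin_all_exists[r rE] (j : 'I_#[c]%g) : exists r : rat,
    tf_trace (group_form F gT)
      (casimir_poly (group_form F gT) q * gbasis F (c ^- j)%g) = ratr r.
  have [r rE] := rational_coefs_casimir F q (c ^- j)%g 1%g.
  by exists (#|gT|%:R * r); rewrite /= /group_trace rE rmorphM /= ratr_nat.
pose P := \poly_(j < #[c]%g) (if insub j is Some j' then r j' else 0) - (#[c]%g * m)%:R%:P.
have PE y : (map_poly ratr P).[y] =
    #[c]%g%:R * (p'_character V p (root_average c y) - m%:R).
  rewrite -(trace_sieve (group_form F gT) VC _ qV) rmorphB /= hornerD hornerN.
  rewrite map_polyC hornerC /= ratr_nat natrM mulrBr; congr (_ - _).
  rewrite -scalerAr linearZ /= mulrA mulfV ?order_neq0 // mul1r.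
  rewrite mulr_sumr raddf_sum /= poly_def rmorph_sum horner_sum.
  apply: eq_bigr => j _; rewrite /= -mul_polyC rmorphM /= map_polyC map_polyXn.
  rewrite hornerM hornerC hornerXn valK /= -rE -scalerAr linearZ /=.
  by rewrite mulrC.
have : root (map_poly ratr P) z' .
  by apply: (primitive_root_conj zP) => //; rewrite rootE PE mE subrr mulr0.
rewrite rootE PE mE mulf_eq0 (negbTE (order_neq0 _ _)) subr_eq0 => /eqP->.
by [].
Qed.

End GaloisInvariance.

Section RootAverageSum.
Variables (F : numClosedFieldType) (gT : finGroupType).

Lemma sum_cycle (U : nmodType) (c : gT) (u : gT -> U) :
  \sum_(k in <[c]>%g) u k = \sum_(j < #[c]%g) u (c ^+ j)%g.
Proof.
have inj : injective (fun j : 'I_#[c]%g => c ^+ j)%g.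
  move=> i j /eqP; rewrite eq_expg_mod_order !modn_small // => /eqP.
  exact: val_inj.
rewrite -(big_imset u (in2W inj)) /=; apply: eq_bigl => k.
apply/idP/imsetP => [/cyclePmin[j jn ->]|[j _ ->]]; last exact: mem_cycle.
by exists (Ordinal jn).
Qed.

(** The d-th roots of unity are the characters of the quotient of <c> by <c^d>:
    their idempotents sum up to the idempotent of the trivial action of c^d. *)
Lemma sum_root_average (c : gT) d (z : F) : (d %| #[c]%g)%N ->
  d.-primitive_root z ->
  \sum_(i < d) root_average c (z ^+ i) = twisted_average <[c ^+ d]>%g (fun=> 1).
Proof.
move=> dn zP; set n := #[c]%g in dn *.
have d0 := prim_order_gt0 zP; have n0 : (0 < n)%N := order_gt0 c.
have geom j : \sum_(i < d) z ^+ i ^+ j = if (d %| j)%N then d%:R else 0.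
  under eq_bigr => i _ do rewrite exprAC.
  case: ifP => [|dj].
    rewrite (prim_order_dvd zP) => /eqP ->.
    by under eq_bigr => i _ do rewrite expr1n; rewrite sumr_const card_ord.
  apply/eqP; have := subrX1 (z ^+ j) d.
  rewrite exprAC (prim_expr_order zP) expr1n subrr => /esym/eqP.
  by rewrite mulf_eq0 subr_eq0 -(prim_order_dvd zP) dj.
have memX j : (c ^+ j \in <[c ^+ d]>)%g = (d %| j)%N.
  apply/cycleP/idP => [[k]|/dvdnP[k ->]]; last by exists k; rewrite mulnC expgM.
  rewrite -expgM => /eqP; rewrite eq_expg_mod_order => /eqP jk.
  by rewrite /dvdn -(modn_dvdm _ dn) jk modn_dvdm // modnMr.
have sumK : \sum_(k in <[c ^+ d]>%g) gbasis F k^-1%g =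
    \sum_(j < n) (d %| j)%N%:R *: gbasis F (c ^- j)%g.
  transitivity (\sum_(k in <[c]>%g) (k \in <[c ^+ d]>%g)%:R *: gbasis F k^-1%g).
    rewrite [RHS](bigID (mem <[c ^+ d]>%g)) /= [X in _ + X]big1 ?addr0; last first.
      by move=> k /andP[_ /negbTE->]; rewrite scale0r.
    apply: eq_big => [k|k ->]; last by rewrite scale1r.
    by apply/idP/andP => [kd|[]//]; split=> //; apply: subsetP kd; rewrite cycle_subG mem_cycle.
  by rewrite sum_cycle; apply: eq_bigr => j _; rewrite memX.
rewrite /twisted_average; under [in RHS]eq_bigr => k _ do rewrite scale1r.
have cardK : #|<[c ^+ d]>%g|%:R = n%:R / d%:R :> F.
  rewrite -/#[_]%g orderXdiv // -/n; apply: (canRL (mulfK _)).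
    by rewrite pnatr_eq0 -lt0n.
  by rewrite -natrM divnK.
rewrite sumK cardK invf_div -scaler_sumr exchange_big /= mulrC -scalerA.
congr (_ *: _); rewrite scaler_sumr; apply: eq_bigr => j _.
rewrite -scaler_suml geom scalerA; congr (_ *: _).
by case: ifP; rewrite ?mulr1 ?mulr0.
Qed.

End RootAverageSum.

Section ProjectiveMcKay.
Variables (F : numClosedFieldType) (p : nat).

Lemma mu_inflation (hT kT : finGroupType) (f : hT -> kT) n
    (V : 'I_n -> lmodule (group_alg F hT)) :
  (forall a b, f (a * b)%g = (f a * f b)%g) -> (forall y, exists a, f a = y) ->
  complete_simples V ->
  (mu (group_alg F kT) p)%:R =
  p'_character V p (twisted_average [set a | f a == 1%g] (fun=> 1)).
Proof.
move=> fM f_onto VC.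
have [m [W WC]] := complete_simples_exist (group_form F kT).
have [q qs] := sieve_exists p (simple_dims V ++ simple_dims W).
have qV : sieve p (simple_dims V) q.
  by apply: sieve_sub qs => d; rewrite mem_cat => ->.
have qW : sieve p (simple_dims W) q.
  by apply: sieve_sub qs => d; rewrite mem_cat orbC => ->.
rewrite -(p'_character1 WC) -(trace_sieve (group_form F kT) WC _ qW) mulr1.
by rewrite (inflation_trace F fM f_onto) (trace_sieve (group_form F hT) VC _ qV).
Qed.

Hypothesis mc1 : MC1 F p.
Variables (gT : finGroupType) (c : gT) (Q : {group gT}).
Hypothesis cZ : c \in 'Z([set: gT])%g.
Hypothesis sylQ : (p.-Sylow([set: gT]) Q)%g.
Local Notation nT := (subg_of 'N(Q)).
Variables (n : nat) (V : 'I_n -> lmodule (group_alg F gT)).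
Variables (m : nat) (W : 'I_m -> lmodule (group_alg F nT)).
Hypothesis VC : complete_simples V.
Hypothesis WC : complete_simples W.
Local Notation c' := (subg 'N(Q) c).

Lemma central_norm : c \in 'N(Q)%g.
Proof.
case/setIP: cZ => _ /centP cC; apply: (subsetP (cent_sub Q)).
by apply/centP => x _; apply: cC; rewrite inE.
Qed.

Lemma sgval_central : sgval c' = c.
Proof. by apply: subgK; exact: central_norm. Qed.

Lemma order_subg : #[c']%g = #[c]%g.
Proof. by rewrite -[in RHS]sgval_central (order_injm (injm_sgval _)) ?inE. Qed.

(** Both sums count simple modules on which c^d acts trivially, that is, simple
    modules of the group divided by <c^d>, and of the Sylow normalizer in this
    quotient; the McKay hypothesis for the quotient makes them equal. *)
Lemma mu_root_averages d (z : F) : (d %| #[c]%g)%N -> d.-primitive_root z ->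
  \sum_(i < d) p'_character V p (root_average c (z ^+ i)) =
  \sum_(i < d) p'_character W p (root_average c' (z ^+ i)).
Proof.
move=> dn zP.
have p'_sum k (gT' : finGroupType) (U : 'I_k -> lmodule (group_alg F gT'))
    (x : 'I_d -> group_alg F gT') :
    \sum_i p'_character U p (x i) = p'_character U p (\sum_i x i).
  rewrite exchange_big; apply: eq_bigr => i _ /=.
  by rewrite raddf_sum mulr_suml.
rewrite !p'_sum sum_root_average // sum_root_average ?order_subg //.
pose K := <[c ^+ d]>%G.
have KZ : (K \subset 'Z([set: gT]))%g by rewrite cycle_subG groupX.
have nK : ([set: gT] \subset 'N(K))%g.
  apply: normal_norm; exact: sub_center_normal.
pose f := [morphism of restrm nK (coset K)].
have fE a : f a = coset K a by [].
have fM a b : f (a * b)%g = (f a * f b)%g by rewrite morphM ?inE.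
have f_onto y : exists a, f a = y.
  by have [a _ ->] := cosetP y; exists a.
have kerf : ('ker f)%g = K :> {set gT} by rewrite ker_restrm ker_coset setTI.
have imf : (f @* [set: gT])%g = [set: coset_of K].
  apply/setP => y; rewrite inE; have [a <-] := f_onto y.
  by rewrite mem_morphim ?inE.
have f1 a : (f a == 1%g) = (a \in K).
  by rewrite -[in RHS]kerf !inE /=.
have kerZ : ('ker f \subset 'Z([set: gT]))%g by rewrite kerf.
have sylfQ : (p.-Sylow([set: coset_of K]) (f @* Q))%g.
  by rewrite -imf; exact: morphim_Sylow_central.
have normE := morphim_norm_central_ker kerZ sylQ.
rewrite imf setTI in normE.
pose f' (a : nT) : subg_of 'N(f @* Q) := subg _ (f (sgval a)).
have f'E a : sgval (f' a) = f (sgval a).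
  apply: subgK; have : f (sgval a) \in (f @* 'N(Q))%g.
    exact: mem_morphim (in_setT _) (subgP a).
  by rewrite normE.
have f'M a b : f' (a * b)%g = (f' a * f' b)%g.
  by apply: (can_inj (@sgvalK _ _)); rewrite sgvalM ?inE // !f'E -fM sgvalM ?inE.
have f'_onto y : exists a, f' a = y.
  have : sgval y \in (f @* 'N(Q))%g by rewrite normE subgP.
  case/morphimP => a _ aN ya; exists (subg 'N(Q) a).
  by apply: (can_inj (@sgvalK _ _)); rewrite f'E subgK.
have f'1 a : (f' a == 1%g) = (a \in <[c' ^+ d]>%g).
  rewrite -(inj_eq (can_inj (@sgvalK _ _))) f'E [sgval 1%g]/= f1.
  have imK : (sgval @* <[c' ^+ d]> = <[c ^+ d]>)%g.
    by rewrite morphim_cycle ?inE // morphX ?inE //= sgval_central.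
  rewrite /K /= -imK; apply/idP/idP => [|aK]; last by rewrite mem_morphim ?inE.
  by case/morphimP=> b _ bK /(can_inj (@sgvalK _ _))->.
have -> : <[c ^+ d]>%g = [set a | f a == 1%g] by apply/setP => a; rewrite inE f1.
have -> : <[c' ^+ d]>%g = [set a | f' a == 1%g].
  by apply/setP => a; rewrite inE f'1.
rewrite -(mu_inflation fM f_onto VC) -(mu_inflation f'M f'_onto WC).
congr (_%:R); exact: mc1 sylfQ.
Qed.

(** Induction on the order d of z.  In the equality of the sums over all the d-th
    roots of unity, the roots of smaller order cancel by induction, and those of
    order d all contribute the same difference. *)
Theorem projective_mckay z : z ^+ #[c]%g = 1 ->
  p'_character V p (root_average c z) = p'_character W p (root_average c' z).
Proof.
move=> zn; have [d zP dn] := prim_order_exists (order_gt0 c) zn.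
have c'Z : c' \in 'Z([set: nT])%g.
  apply/setIP; split; rewrite ?inE //; apply/centP => a _.
  apply: (can_inj (@sgvalK _ _)); rewrite !sgvalM ?inE // sgval_central.
  by case/setIP: cZ => _ /centP->; rewrite ?inE.
elim/ltn_ind: d z zP dn {zn} => d IHd z zP dn.
have d0 := prim_order_gt0 zP.
pose D x := p'_character V p (root_average c x) - p'_character W p (root_average c' x).
suff : D z = 0 by move/eqP; rewrite subr_eq0 => /eqP.
have Dconj x : d.-primitive_root x -> D x = D z.
  move=> xP; rewrite /D (p'_character_conj cZ VC _ dn xP zP).
  by rewrite (p'_character_conj c'Z WC _ _ xP zP) // order_subg.
have := mu_root_averages dn zP => /eqP; rewrite -subr_eq0 -sumrB.
(* z^i has order d / gcd(i, d), which is less than d unless i is prime to d. *)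
rewrite (bigID (fun i : 'I_d => coprime i d)) /= [X in _ + X]big1 ?addr0 => [|i id]; last first.
  have eP : (d %/ gcdn i d).-primitive_root (z ^+ i) by exact: exp_prim_root.
  apply/eqP; rewrite subr_eq0; apply/eqP; apply: IHd eP _.
    by rewrite ltn_Pdiv // ltn_neqAle eq_sym id gcdn_gt0 d0 orbT.
  by apply: dvdn_trans dn; rewrite dvdn_div // dvdn_gcdr.
rewrite (eq_bigr (fun=> D z)) => [|i id]; last first.
  by apply: Dconj; have := exp_prim_root zP i; rewrite (eqP id) divn1.
rewrite sumr_const -mulr_natr mulf_eq0 pnatr_eq0 => /orP[/eqP//|].
(* 1 mod d, rather than 1, is an index below d also when d = 1. *)
move=> /eqP/card0_eq/(_ (Ordinal (ltn_pmod 1 d0))).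
by rewrite -[LHS]/(coprime (1 %% d) d) coprime_modl coprime1n.
Qed.
End ProjectiveMcKay.

(** * The trace form of a twisted quantum double *)

Section DoubleForm.
Variables (F : numClosedFieldType) (gT : finGroupType) (w : cocycle3 F gT).
Local Notation D := (twisted_double w).

Definition dbasis (x g : gT) : D := basis_elt F (x, g).

Lemma dbasisM x g y h : dbasis x g * dbasis y h =
  if x == (g * y * g^-1)%g then alpha w x g h *: dbasis x (g * h)%g else 0.
Proof. exact: twisted_double_mul_basis. Qed.

Lemma dbasis_expand (a : D) : a = \sum_(u : gT * gT) a u *: dbasis u.1 u.2.
Proof. by rewrite [LHS]basis_eltE; apply: eq_bigr => -[]. Qed.

Lemma dbasis_sum1 : 1 = \sum_x dbasis x 1%g.
Proof. by []. Qed.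

Lemma dcoefD (a b : D) u : (a + b) u = a u + b u.
Proof. by rewrite ffunE. Qed.

Lemma dcoefZ k (a : D) u : (k *: a) u = k * a u.
Proof. by rewrite ffunE. Qed.

Lemma dbasis_coef x g u : dbasis x g u = (u == (x, g))%:R.
Proof. by rewrite ffunE. Qed.

Definition double_trace (a : D) : F := #|gT|%:R * \sum_x a (x, 1%g).

Lemma double_trace_is_scalar : scalar double_trace.
Proof.
move=> k a b; rewrite /double_trace mulrCA -mulrDr; congr (_ * _).
by rewrite mulr_sumr -big_split; apply: eq_bigr => x _; rewrite dcoefD dcoefZ.
Qed.
HB.instance Definition _ := GRing.isSemilinear.Build F D F *%R double_trace
  (GRing.semilinear_linear double_trace_is_scalar).

Lemma double_trace_dbasis x g : double_trace (dbasis x g) = (#|gT| * (g == 1%g))%:R.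
Proof.
rewrite /double_trace natrM; congr (_ * _).
rewrite (bigD1 x) //= big1 => [|y yx]; rewrite dbasis_coef xpair_eqE.
  by rewrite eqxx addr0 eq_sym.
by rewrite (negbTE yx).
Qed.

(** The left and right inverses of e(x) (x) g have the same scalar. *)
Lemma alphaV x g : alpha w x g g^-1%g = alpha w (g^-1 * x * g)%g g^-1%g g.
Proof. by have := alphaM w x g g^-1%g g; rewrite mulgV mulVg alpha1l alpha1r mulr1 mul1r. Qed.

(** The inverse of e(x) (x) g in the groupoid sense: the products on both sides
    are e(x) and e(g^-1 x g). *)
Definition dinv (x g : gT) : D :=
  (alpha w x g g^-1%g)^-1 *: dbasis (g^-1 * x * g)%g g^-1%g.

Lemma dbasis_dinv x g : dbasis x g * dinv x g = dbasis x 1%g.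
Proof.
rewrite -scalerAr dbasisM !mulgA mulgV mul1g mulgK eqxx scalerA.
by rewrite mulVf ?alpha_neq0 // scale1r.
Qed.

Lemma dinv_dbasis x g : dinv x g * dbasis x g = dbasis (g^-1 * x * g)%g 1%g.
Proof.
rewrite -scalerAl dbasisM invgK eqxx scalerA -alphaV.
by rewrite mulVf ?alpha_neq0 // scale1r mulVg.
Qed.

Lemma double_traceC a b : double_trace (a * b) = double_trace (b * a).
Proof.
rewrite (dbasis_expand a) mulr_suml mulr_sumr !raddf_sum; apply: eq_bigr => -[x g] _ /=.
rewrite (dbasis_expand b) mulr_suml mulr_sumr !raddf_sum; apply: eq_bigr => -[y h] _ /=.
rewrite -!scalerAl -!scalerAr !linearZ /= mulrCA; congr (_ * (_ * _)).
rewrite !dbasisM.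
have [ghE|gh] := eqVneq (g * h)%g 1%g; last first.
  have hg : (h * g)%g != 1%g.
    apply: contraNneq gh => hg; have -> : g = h^-1%g; last by rewrite mulVg.
    by apply: (mulgI h); rewrite hg mulgV.
  have tr0 k z l : l != 1%g -> double_trace (k *: dbasis z l) = 0.
    by move=> l1; rewrite linearZ /= double_trace_dbasis (negbTE l1) muln0 mulr0.
  by case: ifP => _; case: ifP => _; rewrite ?tr0 ?raddf0.
have -> : h = g^-1%g by apply: (mulgI g); rewrite ghE mulgV.
rewrite invgK mulgV mulVg.
have -> : (y == g^-1 * x * g)%g = (x == g * y * g^-1)%g.
  by apply/eqP/eqP => ->; rewrite !mulgA ?mulVg ?mulgV mul1g ?mulgK ?mulgKV.
case: eqP => [->|_]; last by rewrite raddf0.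
rewrite !linearZ /= !double_trace_dbasis; congr (_ * _).
by rewrite alphaV !mulgA mulVg mul1g mulgKV.
Qed.

Definition ddual (u : gT * gT) : D := #|gT|%:R^-1 *: dinv u.1 u.2.

Lemma double_orth u v :
  double_trace (dbasis u.1 u.2 * ddual v) = (u == v)%:R.
Proof.
case: u v => [x g] [y h] /=; rewrite xpair_eqE -!scalerAr !linearZ /= dbasisM.
case: eqP => [xE|xE].
  rewrite linearZ /= double_trace_dbasis -eq_mulgV1.
  case: eqP => [gh|_]; last by rewrite andbF muln0 !mulr0.
  have xy : x = y by rewrite xE gh !mulgA mulgV mul1g mulgK.
  rewrite xy gh eqxx /= muln1 (mulrA (alpha _ _ _ _)^-1) mulVf ?alpha_neq0 //.
  by rewrite mul1r mulVf // cardT_neq0.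
rewrite raddf0 !mulr0; case: eqP => [xy|//]; case: eqP => // gh; case: xE.
by rewrite xy gh !mulgA mulgV mul1g mulgK.
Qed.

Lemma double_expand a : a = \sum_u double_trace (a * ddual u) *: dbasis u.1 u.2.
Proof.
rewrite [LHS]dbasis_expand; apply: eq_bigr => u _; congr (_ *: _).
rewrite [in RHS](dbasis_expand a) mulr_suml raddf_sum (bigD1 u) //= big1.
  by rewrite -scalerAl linearZ /= double_orth eqxx mulr1 addr0.
by move=> v vu; rewrite -scalerAl linearZ /= double_orth (negbTE vu) mulr0.
Qed.

Lemma double_sum1 : \sum_u ddual u * dbasis u.1 u.2 = 1.
Proof.
rewrite -(pair_bigA _ (fun x g => ddual (x, g) * dbasis x g)) exchange_big /=.
rewrite (eq_bigr (fun=> #|gT|%:R^-1 *: 1)) => [|g _].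
  by rewrite sumr_const -scaler_nat scalerA mulfV ?cardT_neq0 ?scale1r.
rewrite dbasis_sum1 [in RHS](reindex_inj (conjg_inj g)) scaler_sumr; apply: eq_bigr => x _ /=.
by rewrite -scalerAl dinv_dbasis conjgE mulgA.
Qed.

Definition double_form : trace_form D :=
  TraceForm double_traceC double_expand double_orth double_sum1.

End DoubleForm.

(** * Corners of a twisted quantum double *)

Section Corner.
Variables (F : numClosedFieldType) (gT : finGroupType) (w : cocycle3 F gT).
Variables (x : gT) (eT : finGroupType) (pi : eT -> gT) (s : eT -> F).
Local Notation D := (twisted_double w).
Local Notation C := ('C[x])%g.
Hypothesis piM : forall a b, pi (a * b)%g = (pi a * pi b)%g.
Hypothesis pi_onto : pi @: [set: eT] = C.
Hypothesis s_neq0 : forall a, s a != 0.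
Hypothesis sM : forall a b, s (a * b)%g = s a * s b * alpha w x (pi a) (pi b).


(** A group eT mapping onto C(x), along which alpha_x becomes the coboundary of
    s^-1: corner_elt is then a homomorphism from eT to the units of the corner at
    e(x). *)
Definition corner_elt (a : eT) : D := s a *: dbasis w x (pi a).

Lemma pi_cent a : pi a \in C.
Proof. by rewrite -pi_onto imset_f ?inE. Qed.

Lemma cent1_conj g : g \in C -> (g * x * g^-1)%g = x /\ (g^-1 * x * g)%g = x.
Proof.
by move=> /cent1P gx; split; rewrite ?(commuteP gx) 1?gx -?mulgA -?gx ?mulKg ?mulgV ?mulg1.
Qed.

Lemma corner_eltM a b : corner_elt (a * b)%g = corner_elt a * corner_elt b.
Proof.
rewrite /corner_elt -scalerAl -scalerAr dbasisM (cent1_conj (pi_cent a)).1 eqxx.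
by rewrite !scalerA sM piM.
Qed.

Lemma corner_s1 : s 1%g = 1.
Proof.
apply: (mulfI (s_neq0 1%g)); rewrite mulr1 -[in RHS](mulg1 1%g) sM (hom1 piM).
by rewrite alpha1l mulr1.
Qed.

Lemma corner_elt1 : corner_elt 1%g = dbasis w x 1%g.
Proof. by rewrite /corner_elt corner_s1 (hom1 piM) scale1r. Qed.

Lemma corner_eltV a : corner_elt a^-1%g = (s a)^-1 *: dinv w x (pi a).
Proof.
rewrite /corner_elt /dinv (cent1_conj (pi_cent a)).2 scalerA (homV piM).
congr (_ *: _); apply: (mulfI (s_neq0 a)).
apply: (mulIf (alpha_neq0 w x (pi a) (pi a)^-1%g)).
have := sM a a^-1%g; rewrite mulgV corner_s1 (homV piM) => <-.
by rewrite (mulVKf (s_neq0 a)) mulVf ?alpha_neq0.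
Qed.

Definition dcomm (g h : gT) : D :=
  dbasis w x g * dbasis w x h * dinv w x g * dinv w x h.

Lemma corner_comm a b : corner_elt (a * b * a^-1 * b^-1)%g = dcomm (pi a) (pi b).
Proof.
rewrite !corner_eltM !corner_eltV /corner_elt /dcomm.
move: (dinv w x (pi a)) (dinv w x (pi b)) => da db.
rewrite -!scalerAr -!scalerAl !scalerA.
set k := (X in X *: _); suff -> : k = 1 by rewrite scale1r.
by rewrite /k; field; rewrite !s_neq0.
Qed.

(** The product of four basis elements behind a term of casimir2 must be a closed
    path at x in the action groupoid that runs along g, h, g^-1 and h^-1.  Tracing
    its four vertices shows that both g and h fix x. *)
Lemma casimir2_corner : casimir2 (double_form w) * dbasis w x 1%g =
  #|gT|%:R ^- 2 *: \sum_(g in C) \sum_(h in C) dcomm g h.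
Proof.
pose term u v : D := dbasis w u.1 u.2 * dbasis w v.1 v.2 * dinv w u.1 u.2 * dinv w v.1 v.2.
have dinv_unit y h : dinv w y h * dbasis w x 1%g = if y == x then dinv w y h else 0.
  rewrite /dinv -scalerAl dbasisM invgK alpha1r scale1r mulg1.
  have -> : (h^-1 * y * h == h^-1 * x * h)%g = (y == x).
    by rewrite (inj_eq (mulIg h)) (inj_eq (mulgI h^-1%g)).
  by case: ifP => _; rewrite ?scaler0.
have dbasis0 y g z h : y != (g * z * g^-1)%g -> dbasis w y g * dbasis w z h = 0.
  by move=> /negbTE yz; rewrite dbasisM yz.
have term0 y g h : ~~ [&& y == x, g \in C & h \in C] -> term (y, g) (x, h) = 0.
  move=> nC; rewrite /term /=.
  have [yE|yx] := eqVneq y (g * x * g^-1)%g; last by rewrite dbasis0 ?mul0r.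
  have yg : (g^-1 * y * g = x)%g by rewrite yE !mulgA mulVg mul1g mulgKV.
  have [hC|hC] := boolP (h \in C).
    have [hx hx'] := cent1_conj hC.
    rewrite -mulrA [X in _ * X](_ : _ = 0) ?mulr0 //.
    rewrite /dinv -scalerAl -scalerAr yg hx'.
    rewrite [_ * _]dbasis0 ?scaler0 // invgK.
    apply: contra nC => /eqP xE; have xy : y = x by rewrite yE xE !mulgA mulgV mul1g mulgK.
    rewrite xy eqxx hC andbT; apply/cent1P; rewrite /commute {1}xE.
    by rewrite !mulgA mulgV mul1g.
  move: (dinv w x h) => dh; rewrite /dinv yg dbasisM -yE eqxx -scalerAl -scalerAr.
  rewrite [dbasis _ _ _ * _]dbasis0 ?scaler0 ?mul0r //.
  apply: contra hC => /eqP; rewrite yE invMg !mulgA => /mulIg.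
  rewrite -!mulgA => /mulgI; rewrite !mulgA => xE.
  by apply/cent1P; rewrite /commute {2}xE mulgKV.
rewrite /casimir2 mulr_suml.
transitivity (\sum_u \sum_v (if v.1 == x then #|gT|%:R ^- 2 *: term u v else 0)).
  apply: eq_bigr => u _; rewrite mulr_suml; apply: eq_bigr => v _ /=.
  rewrite /ddual /term; have := dinv_unit v.1 v.2.
  move: (dinv w v.1 v.2) (dinv w u.1 u.2) => dv du dvx.
  rewrite -!scalerAr -!scalerAl scalerA -(mulrA _ dv) dvx.
  case: ifP => _; last by rewrite mulr0 scaler0.
  by rewrite expr2 invfM.
transitivity (\sum_u \sum_h #|gT|%:R ^- 2 *: term u (x, h)).
  apply: eq_bigr => u _.
  rewrite -(pair_bigA _ (fun y h => if y == x then #|gT|%:R ^- 2 *: term u (y, h) else 0)) /=.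
  rewrite (bigD1 x) //= eqxx [X in _ + X]big1 ?addr0 // => y /negbTE yx.
  by rewrite big1 // => h _; rewrite yx.
rewrite scaler_sumr.
rewrite -(pair_bigA _ (fun y g => \sum_h #|gT|%:R ^- 2 *: term (y, g) (x, h))) /=.
rewrite (bigD1 x) //= [X in _ + X]big1 ?addr0 => [|y yx]; last first.
  rewrite big1 // => g _; rewrite big1 // => h _; rewrite term0 ?scaler0 //.
  by rewrite (negbTE yx).
rewrite [LHS](bigID (mem C)) /= [X in _ + X]big1 ?addr0 => [|g gC]; last first.
  rewrite big1 // => h _; rewrite term0 ?scaler0 //.
  by rewrite (negbTE gC) andbF.
apply: eq_bigr => g gC; rewrite (bigID (mem C)) /= [X in _ + X]big1 ?addr0.
  by rewrite scaler_sumr.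
move=> h hC; rewrite term0 ?scaler0 //.
by rewrite (negbTE hC) !andbF.
Qed.

Local Notation K := [set a | pi a == 1%g].
Local Notation m := #|(x ^: [set: gT])%g|.
Local Notation GE := (group_form F eT).
Local Notation avg := (twisted_average K s).

Lemma card_corner : #|gT| = (m * #|C|)%N.
Proof.
rewrite -index_cent1 -[#|gT|]cardsT -(LagrangeI [set: gT]%G 'C[x]%G) /=.
by rewrite !setTI mulnC.
Qed.

Let card_eT : #|eT| = (#|C| * #|K|)%N.
Proof. by rewrite (card_hom piM) pi_onto. Qed.

Let C0 : #|C|%:R != 0 :> F.
Proof. by rewrite pnatr_eq0 -lt0n cardG_gt0. Qed.

Let K0 : #|K|%:R != 0 :> F.
Proof. by apply: contraNneq (cardT_neq0 F eT) => K0; rewrite card_eT natrM K0 mulr0. Qed.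

Lemma class_size_neq0 : m%:R != 0 :> F.
Proof.
by apply: contraNneq (cardT_neq0 F gT) => m0; rewrite card_corner natrM m0 mul0r.
Qed.

Let phi : {linear group_alg F eT -> D} := glift corner_elt.

Let phiE a : phi (gbasis F a) = corner_elt a.
Proof. exact: glift_gbasis. Qed.

(** Both sides are averages of commutators of the corner.  On the left one
    divides by #|gT|^2, on the right by #|C(x)|^2, whence the scalar m^-2, where m
    is the size of the class of x. *)
Lemma corner_casimir2 : casimir2 (double_form w) * dbasis w x 1%g =
  phi (m%:R ^- 2 *: casimir2 GE).
Proof.
rewrite casimir2_corner linearZ casimir2_group linearZ /= scalerA (raddf_sum phi).
transitivity ((m%:R ^- 2 * #|eT|%:R ^- 2) *: \sum_a \sum_b dcomm (pi a) (pi b)).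
  rewrite (sum_hom piM (fun g => \sum_b dcomm g (pi b))) pi_onto.
  rewrite (eq_bigr _ (fun g _ => sum_hom piM (fun h => dcomm g h))) pi_onto.
  rewrite sumrMnl -mulrnA -scaler_nat scalerA card_eT card_corner !natrM; congr (_ *: _).
  by field; rewrite C0 K0 class_size_neq0.
congr (_ *: _); apply: eq_bigr => a _; rewrite raddf_sum; apply: eq_bigr => b _ /=.
by rewrite phiE corner_comm.
Qed.

Lemma corner_trace_lift y :
  double_trace (phi y) = m%:R * group_trace (y * avg).
Proof.
rewrite group_trace_average /phi /glift raddf_sum /= card_eT natrM mulfK //.
rewrite mulrA -natrM -card_corner mulr_sumr [RHS]big_mkcond; apply: eq_bigr => a _ /=.
rewrite /corner_elt scalerA linearZ /= double_trace_dbasis inE.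
by case: eqP => _; rewrite ?muln1 ?muln0 ?mulr0 // mulrC (mulrC (s a)).
Qed.

Lemma corner_trace q :
  tf_trace (double_form w) (casimir_poly (double_form w) q * dbasis w x 1%g) =
  m%:R * tf_trace GE
    (horner_alg (m%:R ^- 2 *: casimir2 GE) (map_poly ratr q) * avg).
Proof.
have phiM b c : phi (b * c) = phi b * phi c by exact: (gliftM corner_eltM).
have phi1 : phi 1 = dbasis w x 1%g by rewrite -gbasis1 phiE corner_elt1.
rewrite /= -corner_trace_lift -phi1 -[in RHS](mulr1 (horner_alg _ _)).
rewrite -(@horner_alg_transfer _ _ _ phi (casimir2 (double_form w))) // => b.
by rewrite -[in LHS](mul1r b) phiM phi1 mulrA corner_casimir2 phiM.
Qed.

Variables (n : nat) (V : 'I_n -> lmodule (group_alg F eT)).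
Hypothesis VC : complete_simples V.

(** A simple module W of eT on which ker pi acts by s comes from a simple module
    of the double of dimension m dim W, whose dimension is prime to p only if m
    is. *)
Lemma corner_sieve p q : sieve p [seq m * d | d <- simple_dims V]%N q ->
  tf_trace (double_form w) (casimir_poly (double_form w) q * dbasis w x 1%g) =
  if coprime m p then m%:R^-1 * p'_character V p avg else 0.
Proof.
move=> qs; rewrite corner_trace (trace_formula GE VC).
have m0 : (0 < m)%N by rewrite lt0n -(pnatr_eq0 F) class_size_neq0.
transitivity (m%:R * \sum_i (mod_dim (V i))%:R *
    ratr q.[(m * mod_dim (V i))%:R ^- 2] * character (V i) avg).
  congr (_ * _); apply: eq_bigr => i _; rewrite -mulrA; congr (_ * _).
  rewrite {1}/character lmodM (module_horner (a := (m * mod_dim (V i))%:R ^- 2)).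
    rewrite mul_scalar_mx linearZ /=; congr (_ * _).
    by rewrite -horner_map /= fmorphV rmorphXn /= ratr_nat.
  rewrite linearZ /= casimir2_simple; last exact: VC.1.1.
  by rewrite scale_scalar_mx natrM exprMn [in RHS]invfM.
have qE i : q.[(m * mod_dim (V i))%:R ^- 2] =
    if coprime m p && coprime (mod_dim (V i)) p then (m * mod_dim (V i))%:R ^- 2 else 0.
  rewrite qs ?coprimeMl ?muln_gt0 ?m0 ?(VC.1.1 i).1 //.
  by apply: map_f; apply: map_f; rewrite mem_enum.
under eq_bigr => i _ do rewrite qE.
case: ifP => mp; last first.
  by rewrite big1 ?mulr0 // => i _; rewrite rmorph0 mulr0 mul0r.
rewrite !mulr_sumr [RHS]big_mkcond; apply: eq_bigr => i _ /=.
case: ifP => _; last by rewrite rmorph0 !(mulr0, mul0r).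
rewrite fmorphV rmorphXn /= ratr_nat natrM.
have d0 : (mod_dim (V i))%:R != 0 :> F by apply: simple_dim_neq0; exact: VC.1.1.
by field; rewrite class_size_neq0 d0.
Qed.

End Corner.

(** * Central extensions from 2-cocycles *)

Record zcocycle2 (n : nat) (hT : finGroupType) := ZCocycle2 {
  zc_fun :> hT -> hT -> 'I_n.+1;
  zc_mul : forall a b c, zc_fun a b + zc_fun (a * b)%g c =
    zc_fun a (b * c)%g + zc_fun b c;
  zc1l : forall b, zc_fun 1%g b = 0;
  zc1r : forall a, zc_fun a 1%g = 0
}.

Definition central_ext (n : nat) (hT : finGroupType) (b : zcocycle2 n hT) : Type :=
  ('I_n.+1 * hT)%type.

Section CentralExtension.
Variables (n : nat) (hT : finGroupType) (b : zcocycle2 n hT).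
Local Notation E := (central_ext b).

HB.instance Definition _ := Finite.on E.

Definition ext_mul (u v : E) : E := (u.1 + v.1 + b u.2 v.2, (u.2 * v.2)%g).
Definition ext_one : E := (0, 1%g).
Definition ext_inv (u : E) : E := (- u.1 - b u.2^-1%g u.2, u.2^-1%g).

Lemma ext_mulA : associative ext_mul.
Proof.
move=> [i g] [j h] [k l]; congr (_, _); rewrite /= ?mulgA //.
transitivity (i + j + k + (b g h + b (g * h)%g l)); last first.
  by rewrite -!addrA; congr (_ + (_ + _)); rewrite addrCA.
by rewrite zc_mul -!addrA; congr (_ + (_ + (_ + _))); rewrite addrC.
Qed.

Lemma ext_mul1 : left_id ext_one ext_mul.
Proof. by move=> [i g]; rewrite /ext_mul /= zc1l add0r addr0 mul1g. Qed.

Lemma ext_mulV : left_inverse ext_one ext_inv ext_mul.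
Proof.
by move=> [i g]; rewrite /ext_mul /ext_inv /= mulVg addrAC subrK addNr.
Qed.

HB.instance Definition _ := Finite_isGroup.Build E ext_mulA ext_mul1 ext_mulV.

Definition ext_gen : E := (inZp 1, 1%g).

Lemma ext_genX j : (ext_gen ^+ j)%g = (inZp j, 1%g).
Proof.
elim: j => [|j IHj]; first by congr (_, _); apply: val_inj; rewrite /= mod0n.
rewrite expgS IHj; congr (_, _); rewrite /= ?mulg1 // zc1l addr0.
by apply: val_inj; rewrite /= modnDm add1n.
Qed.

Lemma ext_gen_central : ext_gen \in 'Z([set: E])%g.
Proof.
apply/setIP; split; rewrite ?inE //; apply/centP => -[i g] _.
by congr (_, _); rewrite /= ?mulg1 ?mul1g // zc1l zc1r !addr0 addrC.
Qed.

End CentralExtension.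

Lemma primitive_root_exists (F : numClosedFieldType) n : (0 < n)%N ->
  exists z : F, n.-primitive_root z.
Proof.
move=> n0; pose q : {poly F} := 'X^n - 1.
have [r qE] := closed_field_poly_normal q.
have q_monic : q \is monic by rewrite monicXnsubC.
move: qE; rewrite (monicP q_monic) scale1r => qE.
have : has n.-primitive_root r.
  apply: (@has_prim_root F n r) => //.
  - apply/allP => z; rewrite -root_prod_XsubC -qE rootE !hornerE subr_eq0.
    by rewrite unity_rootE.
  - by rewrite -separable_prod_XsubC -qE separable_Xn_sub_1 // pnatr_eq0 -lt0n.
  - by rewrite -ltnS -(size_prod_XsubC r id) -qE size_XnsubC.
by case/hasP=> z _ zP; exists z.
Qed.

Section SchurExtension.
Variables (F : numClosedFieldType) (hT : finGroupType) (al : hT -> hT -> F).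
Hypothesis al0 : forall a b, al a b != 0.
Hypothesis alM : forall a b c, al a b * al (a * b)%g c = al a (b * c)%g * al b c.
Hypothesis al1l : forall b, al 1%g b = 1.
Hypothesis al1r : forall a, al a 1%g = 1.

(** Schur's argument: multiplying the cocycle identities al(a,b) al(ab,c) =
    al(a,bc) al(b,c) over all c shows that al^m is the coboundary of
    f0(a) = prod_c al(a,c), for m the order of the group.  Dividing al by the
    coboundary of an m-th root of f0 leaves a cocycle with values in the m-th roots
    of unity, hence an extension of hT by the integers mod m. *)
Lemma schur_extension : exists (eT : finGroupType) (f : eT -> hT) (s : eT -> F) (c : eT),
  [/\ (forall u v, f (u * v)%g = (f u * f v)%g) /\ (forall a, exists u, f u = a),
      (forall u, s u != 0) /\ (forall u v, s (u * v)%g = s u * s v * al (f u) (f v)),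
      c \in 'Z([set: eT])%g & forall u, (f u == 1%g) = (u \in <[c]>%g)].
Proof.
have hT0 : (0 < #|hT|)%N by rewrite -cardsT cardG_gt0.
pose m := #|hT|; have mE : m = m.-1.+1 by rewrite prednK.
have [z zP] := primitive_root_exists F hT0.
pose f0 a := \prod_h al a h.
have f00 a : f0 a != 0 by apply/prodf_neq0.
have alm a b : al a b ^+ m * f0 (a * b)%g = f0 a * f0 b.
  rewrite [f0 a](reindex_inj (mulgI b)) -big_split /= -(eq_bigr _ (fun c _ => alM a b c)).
  by rewrite big_split prodr_const.
pose r a := m.-root (f0 a).
have rm a : r a ^+ m = f0 a by rewrite rootCK.
have r0 a : r a != 0 by rewrite rootC_eq0.
have r1 : r 1%g = 1 by rewrite /r /f0 big1 ?rootC1.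
pose al' a b := al a b * r (a * b)%g / (r a * r b).
have al'm a b : al' a b ^+ m = 1.
  by rewrite expr_div_n !exprMn !rm alm mulfV // mulf_neq0.
(* This is the cocycle normalized to have values in the m-th roots of unity. *)
have al'M a b c : al' a b * al' (a * b)%g c = al' a (b * c)%g * al' b c.
  rewrite /al' mulgA.
  transitivity ((al a b * al (a * b)%g c) * r (a * b * c)%g / (r a * r b * r c)).
    by field; rewrite !r0.
  by rewrite alM; field; rewrite !r0.
pose n := m.-1; have zP' : n.+1.-primitive_root z by rewrite /n -mE.
have zD (i j : 'I_n.+1) : z ^+ (i + j)%R = z ^+ i * z ^+ j.
  by rewrite /= (prim_expr_mod zP') exprD.
have zinj (i j : 'I_n.+1) : z ^+ i = z ^+ j -> i = j.
  move=> /eqP; rewrite (eq_prim_root_expr zP') !modn_small // => /eqP.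
  exact: val_inj.
pose B a b : 'I_n.+1 := inZp (sval (prim_rootP zP (al'm a b))).
have BE a b : z ^+ B a b = al' a b.
  by rewrite /= (prim_expr_mod zP') -(svalP (prim_rootP zP (al'm a b))).
have al'1l b : al' 1%g b = 1 by rewrite /al' al1l r1 mul1g !mul1r divff.
have al'1r a : al' a 1%g = 1 by rewrite /al' al1r r1 mulg1 mul1r mulr1 divff.
have B_mul a b c : B a b + B (a * b)%g c = B a (b * c)%g + B b c.
  by apply: zinj; rewrite !zD !BE.
have B1l b : B 1%g b = 0 by apply: zinj; rewrite BE al'1l expr0.
have B1r a : B a 1%g = 0 by apply: zinj; rewrite BE al'1r expr0.
pose b := ZCocycle2 B_mul B1l B1r.
exists (central_ext b), (fun u : central_ext b => u.2),
  (fun u : central_ext b => z ^+ u.1 / r u.2), (ext_gen b).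
split.
- by split=> // a; exists (0, a).
- split=> [u|[i g] [j h]].
    by rewrite mulf_neq0 ?invr_eq0 ?expf_neq0 // (prim_root_eq0 zP) -lt0n.
  rewrite -[LHS]/(z ^+ (i + j + B g h)%R / r (g * h)%g) !zD BE /=.
  by rewrite /al'; field; rewrite !r0.
- exact: ext_gen_central.
move=> [i g]; apply/eqP/cycleP => [/= ->|[j]].
  by exists i; rewrite ext_genX; congr (_, _); apply: val_inj; rewrite /= modn_small.
by rewrite ext_genX => -[_ ->].
Qed.

End SchurExtension.

(** * Fusion in the centralizer of a Sylow subgroup *)

Section Fusion.
Variables (gT : finGroupType) (p : nat) (P : {group gT}).
Hypothesis p_prime : prime p.
Hypothesis sylP : (p.-Sylow([set: gT]) P)%g.
Local Notation "x ^G" := (x ^: [set: gT])%g (at level 2).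

Lemma card_class_index (hT : finGroupType) (x : hT) :
  #|(x ^: [set: hT])%g| = #|[set: hT] : 'C[x]|%g.
Proof. by rewrite -index_cent1 setTI. Qed.

Lemma class_coprime_cent x : x \in 'C(P)%g -> coprime #|x ^G| p.
Proof.
move=> xP; rewrite card_class_index coprime_sym prime_coprime //.
have PC : (P \subset 'C[x])%g by rewrite sub_cent1.
rewrite -p'natE //; case/and3P: sylP => _ _; apply: pnat_dvd.
exact: indexgS.
Qed.

(** A Sylow p-subgroup of C(y) is then one of the whole group, so that a conjugate
    of it is P. *)
Lemma class_meets_cent y : coprime #|y ^G| p -> exists x, x \in (y ^G :&: 'C(P))%g.
Proof.
rewrite card_class_index coprime_sym prime_coprime // -p'natE // => yp.
have [S sylS] := Sylow_exists p 'C[y]%G.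
have sylST : (p.-Sylow([set: gT]) S)%g.
  rewrite pHallE subsetT /= (card_Hall sylS) -(Lagrange (subsetT 'C[y]%g)).
  by rewrite partnM ?cardG_gt0 ?indexg_gt0 // [X in (_ * X)%N]part_p'nat ?muln1.
have [g _ PE] := Sylow_trans sylST sylP.
exists (y ^ g)%g; rewrite inE; apply/andP; split; first by rewrite memJ_class ?inE.
rewrite PE centJ memJ_conjg; apply/centP => s sS; apply/cent1P.
by rewrite cent1C; apply: (subsetP (pHall_sub sylS)).
Qed.

(** If x and x^g both centralize P, then P and P^g are Sylow subgroups of C(x^g),
    hence conjugate in it; this corrects g to an element of N(P). *)
Lemma burnside_fusion x : x \in 'C(P)%g ->
  (x ^: 'N(P) = x ^G :&: 'C(P))%g.
Proof.
move=> xP; apply/setP => y; apply/idP/setIP => [/imsetP[n nN ->]|[/imsetP[g _ ->] yP]].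
  split; first by rewrite memJ_class ?inE.
  by rewrite -(normP nN) centJ memJ_conjg.
have sylC z : z \in 'C(P)%g -> (p.-Sylow('C[z]) P)%g.
  by move=> zP; apply: pHall_subl sylP; rewrite ?subsetT ?sub_cent1.
have sylPg : (p.-Sylow('C[x ^ g]) (P :^ g))%g.
  by rewrite cent1J pHallJ2 sylC.
have [h hC PE] := Sylow_trans sylPg (sylC _ yP).
have -> : (x ^ g = x ^ (g * h))%g.
  by rewrite conjgM; move/cent1P: hC => hC; rewrite [in RHS]conjgE (hC, esym hC) mulKg.
by rewrite memJ_class //; apply/normP; rewrite conjsgM -PE.
Qed.

Lemma class_subg_norm (y : subg_of 'N(P)) :
  #|(y ^: [set: subg_of 'N(P)])%g| = #|(sgval y ^: 'N(P))%g|.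
Proof.
rewrite -(card_imset _ (can_inj (@sgvalK _ 'N(P)))).
apply: eq_card => z; apply/imsetP/imsetP => [[_ /imsetP[n _ ->] ->]|[n nN ->]].
  by exists (sgval n); rewrite ?subgP // /conjg !sgvalM ?inE.
exists (y ^ subg 'N(P) n)%g; first by rewrite memJ_class ?inE.
by rewrite morphJ ?inE //= subgK.
Qed.

End Fusion.

(** * Comparison of the doubles of a group and of its Sylow normalizer *)

Section CornerExtension.
Variables (F : numClosedFieldType) (gT : finGroupType) (w : cocycle3 F gT) (x : gT).

Lemma corner_extension :
  exists (eT : finGroupType) (pi : {morphism [set: eT] >-> gT}) (s : eT -> F) (c : eT),
  [/\ pi @: [set: eT] = 'C[x]%g, forall u, s u != 0,
      forall u v, s (u * v)%g = s u * s v * alpha w x (pi u) (pi v),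
      c \in 'Z([set: eT])%g & [set u | pi u == 1%g] = <[c]>%g].
Proof.
pose al (a b : subg_of 'C[x]) := alpha w x (sgval a) (sgval b).
have conj_x (a : subg_of 'C[x]) : ((sgval a)^-1 * x * sgval a = x)%g.
  exact: (cent1_conj (subgP a)).2.
have [||||eT [f [s [c [[fM f_onto] [s0 sM] cZ f1]]]]] := @schur_extension _ _ al.
- by move=> a b; exact: alpha_neq0.
- by move=> a b e; rewrite /al !sgvalM ?inE // alphaM conj_x.
- by move=> b; rewrite /al alpha1l.
- by move=> a; rewrite /al alpha1r.
have piM : {in [set: eT] &, {morph (fun u => sgval (f u)) : u v / (u * v)%g}}.
  by move=> u v _ _; rewrite fM sgvalM ?inE.
exists eT, (Morphism piM), s, c; split=> //=.
  apply/setP => g; apply/imsetP/idP => [[u _ ->]|gC]; first exact: subgP.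
  by have [u fu] := f_onto (subg 'C[x] g); exists u; rewrite ?inE //= fu subgK.
apply/setP => u; rewrite inE -f1 -(inj_eq (can_inj (@sgvalK _ 'C[x]%G))).
by [].
Qed.

Lemma twisted_average_cycle (eT : finGroupType) (pi : eT -> gT) (s : eT -> F) (c : eT) :
  (forall u v, pi (u * v)%g = (pi u * pi v)%g) -> (forall u, s u != 0) ->
  (forall u v, s (u * v)%g = s u * s v * alpha w x (pi u) (pi v)) ->
  pi c = 1%g ->
  s c ^+ #[c]%g = 1 /\ twisted_average <[c]>%g s = root_average c (s c).
Proof.
move=> piM s0 sM pic; have s1 := corner_s1 piM s0 sM.
have sX j : s (c ^+ j)%g = s c ^+ j.
  elim: j => [|j IHj]; first by rewrite s1.
  by rewrite expgS sM IHj pic alpha1l mulr1 exprS.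
split; first by rewrite -sX expg_order s1.
rewrite /twisted_average sum_cycle; congr (_ *: _); apply: eq_bigr => j _.
by rewrite sX.
Qed.

End CornerExtension.

Section NormSubgroup.
Variables (gT : finGroupType) (p : nat) (P : {group gT}).
Local Notation N := ('N(P))%g.
Local Notation nT := (subg_of 'N(P)).

Lemma sylow_subg_norm : (p.-Sylow([set: gT]) P)%g ->
  (p.-Sylow([set: nT]) (subg N @* P))%g.
Proof.
move=> sylP; rewrite -(im_subg 'N(P)%G); apply: morphim_pSylow; rewrite ?normG //.
by apply: pHall_subl sylP; rewrite ?subsetT ?normG.
Qed.

Lemma cent_subg_norm (y : nT) : (y \in 'C(subg N @* P))%g = (sgval y \in 'C(P))%g.
Proof.
apply/centP/centP => [yP z zP | yP _ /morphimP[z zN zP ->]].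
  have zN : z \in N by apply: subsetP zP; exact: normG.
  have := yP (subg N z) (mem_morphim _ zN zP).
  by move/(congr1 sgval); rewrite !sgvalM ?inE // subgK.
apply: (can_inj (@sgvalK _ _)); rewrite !sgvalM ?inE // subgK //.
exact: yP.
Qed.

Lemma cent_sub_norm x : x \in 'C(P)%g -> x \in N.
Proof. by move=> xP; apply: subsetP xP; exact: cent_sub. Qed.

End NormSubgroup.

Section ClassTerms.
Variables (F : numClosedFieldType) (p : nat).

(** For a sieving q, the number of simple modules of dimension prime to p that
    live on the class of x, divided by the size of that class. *)
Definition object_term (gT : finGroupType) (w : cocycle3 F gT) q x : F :=
  tf_trace (double_form w) (casimir_poly (double_form w) q * dbasis w x 1%g).

Lemma object_term0 (gT : finGroupType) (w : cocycle3 F gT) x :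
  exists ds, forall q, sieve p ds q ->
  ~~ coprime #|(x ^: [set: gT])%g| p -> object_term w q x = 0.
Proof.
have [eT [pi [s [c [pi_onto s0 sM cZ piK]]]]] := corner_extension w x.
have piM u v : pi (u * v)%g = (pi u * pi v)%g by rewrite morphM ?inE.
have [n [V VC]] := complete_simples_exist (group_form F eT).
exists [seq #|(x ^: [set: gT])%g| * d | d <- simple_dims V]%N => q qs /negbTE xp.
by rewrite /object_term (corner_sieve piM pi_onto s0 sM VC qs) xp.
Qed.

Variable gT : finGroupType.

(** e(x) and e(x^g) are the two products of e(x) (x) g with its inverse, so that
    they have the same trace on every module. *)
Lemma object_termJ (w : cocycle3 F gT) q x g :
  object_term w q (x ^ g)%g = object_term w q x.
Proof.
have [n [V VC]] := complete_simples_exist (double_form w).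
rewrite /object_term !(trace_casimir_poly (double_form w) VC).
apply: eq_bigr => i _; congr (_ * _).
by rewrite -(dbasis_dinv w x g) characterC dinv_dbasis conjgE mulgA.
Qed.

Hypothesis p_prime : prime p.
Hypothesis mc1 : MC1 F p.
Variables (w : cocycle3 F gT) (P : {group gT}).
Hypothesis sylP : (p.-Sylow([set: gT]) P)%g.
Local Notation nT := (subg_of 'N(P)).
Local Notation wN := (restr_cocycle w 'N(P)).

(** The same extension of C(x) serves for the double of N(P): its Sylow normalizer
    is the inverse image of the centralizer of x in N(P), by
    morphim_norm_central_ker, and alpha_x for the restricted cocycle is the
    restriction of alpha_x.  The projective McKay property compares the two. *)
Lemma object_term_mckay x : x \in 'C(P)%g ->
  exists ds, forall q, sieve p ds q ->
  #|(x ^: [set: gT])%g|%:R * object_term w q x =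
  #|(subg 'N(P) x ^: [set: nT])%g|%:R * object_term wN q (subg 'N(P) x).
Proof.
move=> xP; have [eT [pi [s [c [pi_onto s0 sM cZ piK]]]]] := corner_extension w x.
have piM u v : pi (u * v)%g = (pi u * pi v)%g by rewrite morphM ?inE.
have pic : pi c = 1%g.
  have : c \in [set u | pi u == 1%g] by rewrite piK cycle_id.
  by rewrite inE => /eqP.
have [scn avgE] := twisted_average_cycle piM s0 sM pic.
have imf : (pi @* [set: eT])%g = 'C[x]%g by rewrite morphimEdom.
have kerE : ('ker pi)%g = <[c]>%g.
  by rewrite -piK; apply/setP => u; rewrite !inE.
have kerZ : ('ker pi \subset 'Z([set: eT]))%g by rewrite kerE cycle_subG.
(* The Sylow subgroups of C(x) are conjugate, so that one of eT maps onto P. *)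
have [Q sylQ PE] : exists2 Q : {group eT}, (p.-Sylow([set: eT]) Q)%g & (pi @* Q)%g = P.
  have [Q0 sylQ0] := Sylow_exists p [set: eT]%G.
  have sylPC : (p.-Sylow('C[x]) P)%g.
    by apply: pHall_subl sylP; rewrite ?subsetT ?sub_cent1.
  have := morphim_Sylow_central pi sylQ0; rewrite imf => sylpi.
  have [y yC PE] := Sylow_trans sylpi sylPC.
  have : y \in (pi @* [set: eT])%g by rewrite imf.
  case/morphimP=> a _ _ ya; rewrite ya in PE.
  exists (Q0 :^ a)%G; first by rewrite pHallJ ?inE.
  by rewrite /= morphimJ ?inE.
have xN : x \in 'N(P)%g by apply: subsetP xP; exact: cent_sub.
have normE := morphim_norm_central_ker kerZ sylQ; rewrite imf PE in normE.
pose nE := subg_of 'N(Q).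
pose pi' (u : nE) : nT := subg 'N(P) (pi (sgval u)).
have pi'E u : sgval (pi' u) = pi (sgval u).
  apply: subgK; have : pi (sgval u) \in (pi @* 'N(Q))%g.
    exact: mem_morphim (in_setT _) (subgP u).
  by rewrite normE => /setIP[].
pose s' (u : nE) := s (sgval u).
have pi'M u v : pi' (u * v)%g = (pi' u * pi' v)%g.
  by apply: (can_inj (@sgvalK _ _)); rewrite sgvalM ?inE // !pi'E sgvalM ?inE.
have xE : sgval (subg 'N(P) x) = x by apply: subgK.
have centE g : (g \in 'C[subg 'N(P) x])%g = (sgval g \in 'C[x])%g.
  apply/cent1P/cent1P => gx; first by rewrite /commute -xE -!sgvalM ?inE // gx.
  by apply: (can_inj (@sgvalK _ _)); rewrite !sgvalM ?inE // xE.
have pi'_onto : pi' @: [set: nE] = 'C[subg 'N(P) x]%g.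
  apply/setP => g; rewrite centE; apply/imsetP/idP => [[u _ ->]|gC].
    by rewrite pi'E -pi_onto imset_f ?inE.
  have : sgval g \in (pi @* 'N(Q))%g by rewrite normE inE gC subgP.
  case/morphimP => u _ uN gu; exists (subg 'N(Q) u); rewrite ?inE //.
  by apply: (can_inj (@sgvalK _ _)); rewrite pi'E subgK.
have s'0 u : s' u != 0 by exact: s0.
have s'M u v : s' (u * v)%g = s' u * s' v * alpha wN (subg 'N(P) x) (pi' u) (pi' v).
  by rewrite /s' sgvalM ?inE // sM -!pi'E -[in LHS]xE.
have cE : sgval (subg 'N(Q) c) = c by exact: sgval_central.
have pi'K : [set u | pi' u == 1%g] = <[subg 'N(Q) c]>%g.
  have imK : (sgval @* <[subg 'N(Q) c]> = <[c]>)%g.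
    by rewrite morphim_cycle ?inE //= cE.
  apply/setP => u; rewrite inE -(inj_eq (can_inj (@sgvalK _ _))) pi'E.
  transitivity (sgval u \in <[c]>)%g; first by rewrite -piK inE.
  rewrite -imK; apply/idP/idP => [|uK]; last by rewrite mem_morphim ?inE.
  by case/morphimP=> v _ vK /(can_inj (@sgvalK _ _))->.
have pi'c : pi' (subg 'N(Q) c) = 1%g.
  have : subg 'N(Q) c \in [set u | pi' u == 1%g] by rewrite pi'K cycle_id.
  by rewrite inE => /eqP.
have [_ avgE'] := twisted_average_cycle pi'M s'0 s'M pi'c.
have [n [V VC]] := complete_simples_exist (group_form F eT).
have [m [W WC]] := complete_simples_exist (group_form F nE).
set a := #|_|; set b := #|_|.
exists ([seq a * d | d <- simple_dims V] ++ [seq b * d | d <- simple_dims W])%N => q qs.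
have qV : sieve p [seq a * d | d <- simple_dims V]%N q.
  by apply: sieve_sub qs => d; rewrite mem_cat => ->.
have qW : sieve p [seq b * d | d <- simple_dims W]%N q.
  by apply: sieve_sub qs => d; rewrite mem_cat orbC => ->.
have ap : coprime a p by exact: class_coprime_cent sylP _ xP.
have bp : coprime b p.
  apply: (class_coprime_cent p_prime (sylow_subg_norm sylP)).
  by rewrite cent_subg_norm xE.
have a0 : a%:R != 0 :> F by exact: class_size_neq0.
have b0 : b%:R != 0 :> F by exact: class_size_neq0.
rewrite /object_term (corner_sieve piM pi_onto s0 sM VC qV) ap mulVKf //.
rewrite (corner_sieve pi'M pi'_onto s'0 s'M WC qW) bp mulVKf //.
rewrite piK avgE pi'K avgE' /s' cE.
exact: projective_mckay.
Qed.

End ClassTerms.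

Section FusionSum.
Variables (F : numClosedFieldType) (gT : finGroupType) (p : nat) (P : {group gT}).
Local Notation "x ^G" := (x ^: [set: gT])%g (at level 2).

(** A sum over the group of a class function supported by the classes that meet
    C(P), as a sum over C(P): each y is counted through the elements of its class
    that lie in C(P). *)
Lemma fusion_sum (A : gT -> F) :
  (forall x g, A (x ^ g)%g = A x) ->
  (forall y, (y ^G :&: 'C(P))%g = set0 -> A y = 0) ->
  \sum_x A x =
  \sum_(x in 'C(P)%g) #|x ^G|%:R * A x / #|(x ^G :&: 'C(P))%g|%:R.
Proof.
move=> AJ A0.
have classE x y : y \in x ^G -> y ^G = x ^G by move=> /class_eqP.
have Aclass x y : y \in x ^G -> A y = A x by case/imsetP=> g _ ->.
symmetry; transitivity (\sum_(x in 'C(P)%g) \sum_(y in x ^G)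
    A y / #|(y ^G :&: 'C(P))%g|%:R).
  apply: eq_bigr => x xP; rewrite (eq_bigr (fun=> A x / #|(x ^G :&: 'C(P))%g|%:R)).
    by rewrite sumr_const -mulrA mulr_natl.
  by move=> y yx; rewrite (classE _ _ yx) (Aclass _ _ yx).
rewrite (exchange_big_dep predT) //=; apply: eq_bigr => y _.
rewrite sumr_const -[#|_|](_ : #|(y ^G :&: 'C(P))%g| = _); last first.
  apply: eq_card => x; rewrite !inE andbC; congr (_ && _).
  by rewrite -[LHS]class_sym.
have [C0|/set0Pn[z zC]] := eqVneq (y ^G :&: 'C(P))%g set0.
  by rewrite A0 // mul0r mul0rn.
rewrite -[LHS]mulr_natr divfK // pnatr_eq0 -lt0n; apply/card_gt0P.
by exists z.
Qed.

End FusionSum.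

(** mu is the sum of the object terms over the whole group, which is a sum over
    C(P) by fusion_sum; for the double of N(P) only the elements of C(P)
    contribute, P being normal in N(P).  One polynomial q has to sieve the finitely
    many dimensions that occur for all the objects of both doubles. *)
Theorem twisted_double_mckay (F : numClosedFieldType) (p : nat) :
  prime p -> MC1 F p ->
  forall (gT : finGroupType) (w : cocycle3 F gT) (P : {group gT}),
    (p.-Sylow([set: gT]) P)%g ->
    M_pair p (twisted_double w) (twisted_double (restr_cocycle w 'N(P))).
Proof.
move=> p_prime mc1 gT w P sylP.
set nT := subg_of 'N(P); set wN := restr_cocycle w 'N(P).
have [n [V VC]] := complete_simples_exist (double_form w).
have [m [W WC]] := complete_simples_exist (double_form wN).
have [d1 d1P] := fin_all_exists (object_term0 p w).
have [d2 d2P] := fin_all_exists (object_term0 p wN).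
have /fin_all_exists[d3 d3P] (x : gT) : exists ds, x \in 'C(P)%g ->
    forall q, sieve p ds q -> #|(x ^: [set: gT])%g|%:R * object_term w q x =
    #|(subg 'N(P) x ^: [set: nT])%g|%:R * object_term wN q (subg 'N(P) x).
  have [xP|xP] := boolP (x \in 'C(P)%g); last by exists [::].
  by have [ds dsP] := object_term_mckay p_prime mc1 w sylP xP; exists ds.
pose ds := simple_dims V ++ simple_dims W ++
  flatten [seq d1 x | x <- enum gT] ++ flatten [seq d2 x | x <- enum nT] ++
  flatten [seq d3 x | x <- enum gT].
have [q qds] := sieve_exists p ds.
have sub_flatten (I : finType) (d : I -> seq nat) x :
    {subset d x <= flatten [seq d x | x <- enum I]}.
  by move=> k kd; apply/flatten_mapP; exists x; rewrite ?mem_enum.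
have qV : sieve p (simple_dims V) q.
  by apply: sieve_sub qds => d dV; rewrite !mem_cat dV.
have qW : sieve p (simple_dims W) q.
  by apply: sieve_sub qds => d dW; rewrite !mem_cat dW !orbT.
have q1 x : sieve p (d1 x) q.
  by apply: sieve_sub qds => d /sub_flatten h; rewrite !mem_cat h !orbT.
have q2 x : sieve p (d2 x) q.
  by apply: sieve_sub qds => d /sub_flatten h; rewrite !mem_cat h !orbT.
have q3 x : sieve p (d3 x) q.
  by apply: sieve_sub qds => d /sub_flatten h; rewrite !mem_cat h !orbT.
have mu_sum (hT : finGroupType) (v : cocycle3 F hT) k (U : 'I_k -> lmodule (twisted_double v)) :
    complete_simples U -> sieve p (simple_dims U) q ->
    (mu (twisted_double v) p)%:R = \sum_x object_term v q x.
  move=> UC qU; rewrite -(p'_character1 UC) -(trace_sieve (double_form v) UC _ qU).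
  by rewrite dbasis_sum1 mulr_sumr raddf_sum.
apply/eqP; rewrite -(eqr_nat F) (mu_sum _ _ _ _ VC qV) (mu_sum _ _ _ _ WC qW).
apply/eqP; rewrite (@fusion_sum F gT P) => [|x g|y yC]; last 2 first.
- exact: object_termJ.
- apply: d1P => //; apply/negP => /(class_meets_cent p_prime sylP)[z].
  by rewrite yC inE.
rewrite [RHS](bigID (fun y : nT => sgval y \in 'C(P)%g)) /= [X in _ = _ + X]big1 ?addr0; last first.
  move=> y yP; apply: d2P => //; apply: contra yP.
  move=> /(class_meets_cent p_prime (sylow_subg_norm sylP))[z].
  case/setIP=> /imsetP[g _ ->]; rewrite cent_subg_norm morphJ ?inE //=.
  have NP := normP (subgP g); move: (sgval y) (sgval g) NP => u v NP.
  by rewrite -{1}NP centJ memJ_conjg.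
rewrite [RHS](reindex_onto (subg 'N(P)) sgval) => [|y _]; last by rewrite sgvalK.
have subg_cent x : x \in 'C(P)%g -> sgval (subg 'N(P) x) = x.
  by move=> xP; apply: subgK; exact: cent_sub_norm.
apply: eq_big => [x|x xP].
  apply/idP/andP => [xP|[xP /eqP <-]//].
  by rewrite subg_cent ?eqxx.
rewrite (d3P x xP q (q3 x)) -(burnside_fusion sylP xP).
have := class_subg_norm (subg 'N(P) x); rewrite subg_cent // => <-.
rewrite mulrAC divff ?mul1r //.
by rewrite pnatr_eq0 -lt0n; apply/card_gt0P; exists (subg 'N(P) x); exact: class_refl.
Qed.

Theorem theorem3p4 (R : realType) (p : nat) (p_prime : prime p)
    (mc1 : MC1 R[i] p) :
  forall (gT : finGroupType) (w : cocycle3 R[i] gT) (P : {group gT}),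
    (p.-Sylow([set: gT]) P)%g ->
    M_pair p (twisted_double w) (twisted_double (restr_cocycle w 'N(P))).
Proof. exact: twisted_double_mckay p_prime mc1. Qed.
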